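(* Let $\mathcal W_t=\{w_t\in\mathbb C^{N\times 1}:\|w_t\|=1\}$ and $\mathcal W_r=\{w_r\in\mathbb C^{1\times N}:\|w_r\|=1\}$. For $w_r\in\mathcal W_r$, $w_t\in\mathcal W_t$ define the random variable $$\Gamma(w_r,w_t)=\frac{\frac{\eta\theta(1-\theta)\rho^2}{d_1^{2\tau}d_2^{\tau}}\,\|h_1\|^2\,|w_rh_1|^2\,|h_2w_t|^2}{\frac{\eta\theta\rho}{d_1^{\tau}d_2^{\tau}}\,\|h_1\|^2\,|h_2w_t|^2+\frac{(1-\theta)\rho}{d_1^{\tau}}\,|w_rh_1|^2+1}$$ and the ergodic capacity $C(w_r,w_t)=\tfrac12 E\{\log_2(1+\Gamma(w_r,w_t))\}$. Then $C$ is maximized over $\mathcal W_r\times\mathcal W_t$ by taking $w_t$ to be a unit eigenvector of $R_t$ associated with its largest eigenvalue $\sigma_1$, and $w_r=u_r^H$ where $u_r$ is a unit eigenvector of $R_r$ associated with its largest eigenvalue $\lambda_1$.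
   Context: Fix an integer $N\ge 1$ and constants $\eta\in(0,1]$, $\theta\in(0,1)$, $\rho>0$, $d_1,d_2>0$, $\tau>0$. Let $R_r,R_t$ be $N\times N$ Hermitian positive definite matrices with eigenvalues $\lambda_1\ge\dots\ge\lambda_N>0$ and $\sigma_1\ge\dots\ge\sigma_N>0$ respectively, and $R^{1/2}$ denotes the Hermitian positive definite square root. Let $h_{w1}\in\mathbb C^{N\times1}$ and $h_{w2}\in\mathbb C^{1\times N}$ be independent random vectors with i.i.d. zero-mean circularly symmetric complex Gaussian entries of unit variance, and set $h_1=R_r^{1/2}h_{w1}$ (an $N\times1$ vector) and $h_2=h_{w2}R_t^{1/2}$ (a $1\times N$ vector). $\|\cdot\|$ is the Euclidean norm. (This models a rank-one relay processing matrix $\omega w_tw_r$ in a dual-hop power-splitting energy-harvesting relay with only statistical CSI.) *)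

(* Defs.v *)
From HB Require Import structures.
From mathcomp Require Import all_boot all_order all_algebra.
From mathcomp Require Import all_classical all_reals all_analysis.
From mathcomp Require Import complex.

Set Implicit Arguments.
Unset Strict Implicit.
Unset Printing Implicit Defensive.

Import Order.TTheory GRing.Theory Num.Theory.
Local Open Scope ring_scope.

Section Defs.
Variable R : realType.
Local Notation C := (R[i]).

Definition cabs2 (z : C) : R := complex.Re z ^+ 2 + complex.Im z ^+ 2.

Definition vnorm2 m n (A : 'M[C]_(m, n)) : R := \sum_i \sum_j cabs2 (A i j).

Definition ctrmx m n (A : 'M[C]_(m, n)) : 'M[C]_(n, m) := map_mx Num.conj A^T.

Definition posdefmx n (A : 'M[C]_n) : Prop :=
  forall v : 'cV[C]_n, v != 0 -> 0 < (ctrmx v *m A *m v) 0 0.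

Definition log2 (x : R) : R := ln x / ln 2.

(* The SINR Gamma(w_r, w_t) for realizations hw1 (N x 1) and hw2 (1 x N) of
   the white channels; h1 = Sr hw1, h2 = hw2 St, where Sr = Rr^{1/2},
   St = Rt^{1/2}. *)
Definition Gamma (N : nat) (eta theta rho d1 d2 tau : R) (Sr St : 'M[C]_N)
    (wr : 'rV[C]_N) (wt : 'cV[C]_N) (hw1 : 'cV[C]_N) (hw2 : 'rV[C]_N) : R :=
  let h1 := Sr *m hw1 in
  let h2 := hw2 *m St in
  let a := vnorm2 h1 in
  let b := cabs2 ((wr *m h1) 0 0) in
  let c := cabs2 ((h2 *m wt) 0 0) in
  (eta * theta * (1 - theta) * rho ^+ 2 / (d1 `^ (2 * tau) * d2 `^ tau) * a * b * c)
  / (eta * theta * rho / (d1 `^ tau * d2 `^ tau) * a * c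
     + (1 - theta) * rho / d1 `^ tau * b + 1).

(* law of the real and imaginary part of a CN(0,1) entry: N(0, 1/2)
   (normal_prob m s has mean m and standard deviation s) *)
Definition half_gauss : probability _ R := normal_prob (0 : R) (Num.sqrt (2^-1)).

Definition scons (x : C) (v : nat -> C) : nat -> C :=
  fun k => if k is k'.+1 then v k' else x.

(* E{ f(Z_0, ..., Z_{n-1}) } for i.i.d. CN(0,1) variables Z_k (the real and
   imaginary parts being i.i.d. N(0,1/2)), as an iterated integral
   (for nonnegative f this is the expectation, by Tonelli). *)
Fixpoint cgauss_expect (n : nat) (f : (nat -> C) -> \bar R) : \bar R :=
  match n with
  | 0 => f (fun _ => 0)
  | n'.+1 => (\int[half_gauss]_x \int[half_gauss]_y
                cgauss_expect n' (fun v => f (scons (x +i* y)%C v)))%E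
  end.

Definition channel_expect (N : nat) (f : 'cV[C]_N -> 'rV[C]_N -> \bar R) : \bar R :=
  cgauss_expect (N + N)
    (fun v => f (\col_(i < N) v i) (\row_(j < N) v (N + j)%N)).

Definition capacity (N : nat) (eta theta rho d1 d2 tau : R) (Sr St : 'M[C]_N)
    (wr : 'rV[C]_N) (wt : 'cV[C]_N) : \bar R :=
  ((2^-1)%:E * channel_expect (fun hw1 hw2 =>
      (log2 (1 + Gamma eta theta rho d1 d2 tau Sr St wr wt hw1 hw2))%:E))%E.

End Defs.

(* Main.v *)
Require Import Defs.
From HB Require Import structures.
From mathcomp Require Import all_boot all_order all_algebra.
From mathcomp Require Import all_classical all_reals all_analysis.
From mathcomp Require Import measurable_realfun complex ring lra.

(* Write a = ||h_1||^2, b = |w_r h_1|^2, c = |h_2 w_t|^2 and let x = k1 a c and y = k2 b be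
   the two terms of the denominator of Gamma other than 1, so that Gamma = xy/(x+y+1) and
     ln (1 + Gamma) = int_0^oo int_0^oo e^(-s(1+t)) (1 - e^(-sx)) (1 - e^(-sy)) ds dt.
   By Tonelli it suffices to compare, for each s >= 0, the expectations of
   (1 - e^(-sx)) (1 - e^(-sy)).
   Given h_1, the expectation over h_2 is governed by E e^(-q c) = 1/(1 + q w_t^H R_t w_t),
   which is smallest for the top eigenvector of R_t.
   Given h_2, one needs E (1 - e^(-pa)) (1 - e^(-qb)). Rescaling w_r so that
   w_r R_r w_r^H = lambda_1 only increases b, and then E e^(-pa) and E e^(-qb) no longer depend
   on w_r. The remaining term is, by the Gaussian integral E e^(-g^H A g) = 1/det(1 + A) and the
   rank-one determinant formula,
     E e^(-pa-qb) = 1/(det(1 + p R_r) (1 + q y^H (1 + p R_r)^-1 y)),  y = R_r^(1/2) w_r^H,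
   with y^H (1 + p R_r)^-1 y >= ||y||^2/(1 + p lambda_1) and equality at the top eigenvector. *)

Set Implicit Arguments.
Unset Strict Implicit.
Unset Printing Implicit Defensive.

Import Order.TTheory GRing.Theory Num.Theory.
Import numFieldNormedType.Exports.
Local Open Scope classical_set_scope.
Local Open Scope ring_scope.

(** * One-dimensional integrals *)

Section Gaussian.
Context {R : realType}.
Local Notation mu := (@lebesgue_measure R).

(** The Radon-Nikodym derivative of [normal_prob m s] with respect to Lebesgue measure equals
    [normal_pdf m s] almost everywhere, since both have the same integral over every measurable
    set. *)
Lemma ge0_integral_normal_prob (m s : R) (f : R -> \bar R) :
  measurable_fun setT f -> (forall x, 0 <= f x)%E ->
  (\int[normal_prob m s]_x f x = \int[mu]_x (f x * (normal_pdf m s x)%:E))%E.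
Proof.
move=> mf f0; have dom := normal_prob_dominates m s.
rewrite -(Radon_Nikodym_SigmaFinite.change_of_variables dom)//.
have intf := Radon_Nikodym_SigmaFinite.f_integrable dom.
have mpdf : measurable_fun setT (EFin \o normal_pdf m s).
  by apply/measurable_EFinP; exact: measurable_normal_pdf.
apply: ae_eq_integral => //.
- by apply: emeasurable_funM => //; exact: measurable_int intf.
- exact: emeasurable_funM.
- apply: ae_eqe_mul2l => /=; apply: integral_ae_eq => //= E _ mE.
  by rewrite -Radon_Nikodym_SigmaFinite.f_integral.
Qed.

(** The factor e^(x^2) cancels the exponential in the density of N(0, 1/2). What is left is a
    multiple of the density of a normal law with mean [- c] and variance 1/(2s), of total mass one,
    so the value does not depend on [c]. *)
Lemma integral_half_gauss (s c : R) : 0 < s ->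
  (\int[half_gauss R]_x
     (expR (x ^+ 2) * expR (- (s * (x + c) ^+ 2)))%:E)%E
  = ((Num.sqrt s)^-1)%:E.
Proof.
move=> s0; rewrite ge0_integral_normal_prob; last 2 first.
- apply/measurable_EFinP; apply: measurable_funM; apply: measurableT_comp => //.
  apply: measurableT_comp => //; apply: measurable_funM => //.
  by apply: measurable_funX; exact: measurable_funD.
- by move=> x; rewrite lee_fin mulr_ge0// expR_ge0.
have h2 : (0 : R) < 2^-1 by rewrite invr_gt0.
have hs : (0 : R) < (s *+ 2)^-1 by rewrite invr_gt0 mulrn_wgt0.
pose sg := Num.sqrt (s *+ 2)^-1.
have e1 : Num.sqrt (2^-1 : R) ^+ 2 = 2^-1 by rewrite sqr_sqrtr// ltW.
have e2 : sg ^+ 2 = (s *+ 2)^-1 by rewrite sqr_sqrtr// ltW.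
(* The constant is the ratio of the two normalizations, 1/sqrt(pi) for N(0, 1/2) and sqrt(s/pi) for
   N(-c, 1/(2s)). *)
transitivity (\int[mu]_x ((Num.sqrt s)^-1%:E * (normal_pdf (- c) sg x)%:E))%E.
  apply: eq_integral => x _; rewrite -!EFinM; congr EFin.
  rewrite !normal_pdfE ?gt_eqF ?sqrtr_gt0//.
  rewrite /normal_peak /normal_fun e1 e2 subr0 opprK.
  have -> : 2^-1 * pi *+ 2 = pi :> R by field.
  have -> : (s *+ 2)^-1 * pi *+ 2 = s^-1 * pi :> R by field; rewrite gt_eqF.
  rewrite sqrtrM ?invr_ge0 ?ltW// sqrtrV ?ltW//.
  rewrite invfM invrK.
  have -> : - x ^+ 2 / (2^-1 *+ 2) = - x ^+ 2 by field.
  have -> : - (x + c) ^+ 2 / ((s *+ 2)^-1 *+ 2) = - (s * (x + c) ^+ 2).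
    by field; rewrite gt_eqF.
  rewrite [expR (- x ^+ 2)]expRN.
  field.
  by rewrite !gt_eqF ?sqrtr_gt0 ?pi_gt0 ?expR_gt0.
rewrite ge0_integralZl//.
- by rewrite integral_normal_pdf mule1.
- by apply/measurable_EFinP; exact: measurable_normal_pdf.
- by move=> x _; rewrite lee_fin normal_pdf_ge0.
Qed.

End Gaussian.

(** * The double integral representation of ln (1 + xy/(x+y+1)) *)

Section Laplace.
Context {R : realType}.
Local Notation mu := (@lebesgue_measure R).

Lemma one_subr_exp_ge0 (r : R) : 0 <= r -> 0 <= 1 - expR (- r).
Proof. by move=> r0; rewrite subr_ge0 -expR0 ler_expR oppr_le0. Qed.

Definition laplace_kernel (x y s : R) : R :=
  (1 - expR (- (s * x))) * (1 - expR (- (s * y))).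

(** Both factors change sign together at [s = 0]. Nonnegativity for every real [s] later allows
    Tonelli over the whole line. *)
Lemma laplace_kernel_ge0 (x y s : R) : 0 <= x -> 0 <= y -> 0 <= laplace_kernel x y s.
Proof.
move=> x0 y0; rewrite /laplace_kernel; have [s0|/ltW s0] := leP 0 s.
  by rewrite mulr_ge0// one_subr_exp_ge0// mulr_ge0.
by rewrite mulr_le0// subr_le0 -[leLHS]expR0 ler_expR oppr_ge0 mulr_le0_ge0.
Qed.

(** Expanding the product gives four exponentials e^(-as), with a = 1+t, 1+t+x, 1+t+y and 1+t+x+y,
    each of integral 1/a. *)
Lemma integral_laplace_kernel (t x y : R) : 0 <= t -> 0 <= x -> 0 <= y ->
  (\int[mu]_(s in `[0%R, +oo[) (expR (- (s * (1 + t))) * laplace_kernel x y s)%:E)%E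
  = ((1 + t)^-1 - (1 + t + x)^-1 - (1 + t + y)^-1 + (1 + t + x + y)^-1)%:E.
Proof.
move=> t0 x0 y0.
(* [E a] is the antiderivative of e^(-as) that vanishes at infinity. *)
pose E (a s : R) := - (a^-1 * expR (- (a * s))).
pose F (s : R) := E (1 + t) s - E (1 + t + x) s - E (1 + t + y) s + E (1 + t + x + y) s.
have dE (a s : R) : 0 < a -> is_derive s 1 (E a) (expR (- (a * s))).
  move=> a0; rewrite /E; apply: is_derive_eq.
  by rewrite /GRing.scale/= !mulr1; field; rewrite gt_eqF.
have dF (s : R) : is_derive s 1 F (expR (- (s * (1 + t))) * laplace_kernel x y s).
  have h1 : is_derive s 1 (E (1 + t)) _ := dE (1+t) s ltac:(lra).
  have h2 : is_derive s 1 (E (1 + t + x)) _ := dE (1+t+x) s ltac:(lra).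
  have h3 : is_derive s 1 (E (1 + t + y)) _ := dE (1+t+y) s ltac:(lra).
  have h4 : is_derive s 1 (E (1 + t + x + y)) _ := dE (1+t+x+y) s ltac:(lra).
  have h := is_deriveD (is_deriveB (is_deriveB h1 h2) h3) h4.
  apply: is_derive_eq.
  rewrite /laplace_kernel mulrBr !mulrBl !mulrBr !mulr1 !mul1r -!expRD.
  rewrite opprB !addrA addrAC.
  congr (_ + _); last by congr expR; ring.
  congr (_ - _); last by congr expR; ring.
  congr (_ - _); congr expR; ring.
have cE (a : R) : 0 < a -> E a s @[s --> +oo] --> (0 : R).
  move=> a0; rewrite /E -[X in _ --> X]oppr0 -(mulr0 a^-1).
  apply: cvgN; apply: cvgM; first exact: cvg_cst.
  have : expR (- z) @[z --> +oo] --> (0 : R) by exact: cvgr_expR.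
  by apply: cvg_comp; apply: gt0_cvgMry => //; exact: cvg_id.
rewrite (@ge0_continuous_FTC2y _ _ F 0 0).
- rewrite -EFinB; congr EFin; rewrite /F /E !mulr0 oppr0 expR0 !mulr1; ring.
- move=> s s0; rewrite mulr_ge0 ?expR_ge0// laplace_kernel_ge0//.
- apply: continuous_subspaceT => s; apply: differentiable_continuous.
  by apply/derivable1_diffP; rewrite /laplace_kernel; apply: ex_derive.
- rewrite -[X in _ --> X]addr0; apply: cvgD; last by apply: cE; lra.
  rewrite -[X in _ --> X]subr0; apply: cvgB; last by apply: cE; lra.
  by rewrite -[X in _ --> X]subr0; apply: cvgB; apply: cE; lra.
- by move=> s _; apply: ex_derive.
- have /derivable1_diffP/differentiable_continuous := @ex_derive _ _ _ _ _ _ _ (dF 0).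
  exact: cvg_at_right_filter.
- by move=> s _; rewrite derive1E; exact: derive_val.
Qed.

(** The inner integral is a signed sum of four inverses, with antiderivative [G] a signed sum of
    logarithms. [G] tends to 0 at infinity, and [- G 0] is the logarithm of (1+x)(1+y)/(1+x+y),
    which equals 1 + xy/(x+y+1). *)
Lemma ln_laplace (x y : R) : 0 <= x -> 0 <= y ->
  (\int[mu]_(t in `[0%R, +oo[) \int[mu]_(s in `[0%R, +oo[)
     (expR (- (s * (1 + t))) * laplace_kernel x y s)%:E)%E
  = (ln (1 + x * y / (x + y + 1)))%:E.
Proof.
move=> x0 y0.
pose f (t : R) := (1 + t)^-1 - (1 + t + x)^-1 - (1 + t + y)^-1 + (1 + t + x + y)^-1.
transitivity (\int[mu]_(t in `[0%R, +oo[) (f t)%:E)%E.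
  apply: eq_integral => t; rewrite inE/= in_itv/= andbT => t0.
  exact: integral_laplace_kernel.
pose G (t : R) := ln (1 + t) - ln (1 + t + x) - ln (1 + t + y) + ln (1 + t + x + y).
have dL (a t : R) : 0 < 1 + t + a -> is_derive t 1 (fun t => ln (1 + t + a)) (1 + t + a)^-1.
  move=> h; have hl := is_derive1_ln h.
  have ha : is_derive t 1 (fun t : R => 1 + t + a) 1.
    by apply: is_derive_eq; rewrite add0r addr0.
  have hc := @is_derive1_comp _ _ (fun t : R => 1 + t + a) t _ _ hl ha.
  by move: hc; rewrite mulr1.
have dG (t : R) : 0 <= t -> is_derive t 1 G (f t).
  move=> t0.
  have h1 : is_derive t 1 (fun t => ln (1 + t)) (1 + t)^-1.
    have := dL 0 t; rewrite addr0; under eq_fun do rewrite addr0; apply; lra.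
  have h2 := dL x t ltac:(lra).
  have h3 := dL y t ltac:(lra).
  have h4 : is_derive t 1 (fun t => ln (1 + t + x + y)) (1 + t + x + y)^-1.
    have := dL (x + y) t; rewrite addrA; under eq_fun do rewrite addrA; apply; lra.
  exact (is_deriveD (is_deriveB (is_deriveB h1 h2) h3) h4).
have cI (b : R) : (1 + t + b)^-1 @[t --> +oo] --> (0 : R).
  apply/gtr0_cvgV0.
    near=> t.
    have : - (1 + b) < t by near: t; apply: nbhs_pinfty_gt; exact: num_real.
    lra.
  by under eq_fun do rewrite -addrA (addrC _ b) addrA (addrC (1 + b)); exact: cvg_addrr.
have cL (b : R) : ln (1 - x * (1 + t + b)^-1) @[t --> +oo] --> (0 : R).
  have h : 1 - x * (1 + t + b)^-1 @[t --> +oo] --> (1 : R).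
    rewrite -[X in _ --> X]subr0 -[X in _ --> _ - X](mulr0 x).
    by apply: cvgB; [exact: cvg_cst|apply: cvgM; [exact: cvg_cst|exact: cI]].
  rewrite -ln1; apply: (@cvg_comp _ _ _ _ (@ln R) _ (nbhs (1 : R))) h _.
  exact: continuous_ln.
rewrite (@ge0_continuous_FTC2y _ _ G 0 0).
- rewrite -EFinB; congr EFin; rewrite /G !addr0 ln1.
  have -> : 1 + x * y / (x + y + 1) = (1 + x) * (1 + y) / (1 + x + y).
    by field; lra.
  rewrite ln_div ?posrE; [|nra|lra].
  by rewrite lnM ?posrE; [ring|lra|lra].
(* [f t] is nonnegative because it is itself the integral of a nonnegative kernel. *)
- move=> t t0; rewrite -lee_fin -integral_laplace_kernel//; apply: integral_ge0 => s.
  by rewrite /= in_itv/= andbT => s0; rewrite lee_fin mulr_ge0 ?expR_ge0// laplace_kernel_ge0.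
- apply: continuous_in_subspaceT => t; rewrite inE/= in_itv/= andbT => t0.
  have cV (a : R) : 0 <= a -> (1 + z + a)^-1 @[z --> t] --> (1 + t + a)^-1.
    move=> a0; apply: cvgV; first by rewrite gt_eqF//; lra.
    by apply: cvgD; [apply: cvgD; [exact: cvg_cst|exact: cvg_id]|exact: cvg_cst].
  rewrite /continuous_at /f; apply: cvgD; last first.
    have := cV (x + y) ltac:(lra); rewrite addrA.
    by under eq_fun do rewrite addrA.
  apply: cvgB; last exact: cV.
  apply: cvgB; last exact: cV.
  have := cV 0 (lexx _); rewrite addr0.
  by under eq_fun do rewrite addr0.
(* Each logarithm in [G] diverges, so they are paired into ln((1+t)/(1+t+x)) -
   ln((1+t+y)/(1+t+x+y)); both ratios have the form 1 - x/(1+t+b) and tend to 1. *)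
- have h : ln (1 - x * (1 + t + x)^-1) - ln (1 - x * (1 + t + (x + y))^-1)
      @[t --> +oo] --> (0 : R).
    by rewrite -[X in _ --> X]subr0; apply: cvgB; exact: cL.
  apply: (cvg_trans _ h); apply: near_eq_cvg; near=> t.
  have t0 : 0 < t by near: t; apply: nbhs_pinfty_gt; exact: num_real.
  rewrite /G.
  have -> : 1 - x * (1 + t + x)^-1 = (1 + t) / (1 + t + x) by field; lra.
  have -> : 1 - x * (1 + t + (x + y))^-1 = (1 + t + y) / (1 + t + x + y) by field; lra.
  by rewrite !ln_div ?posrE; [ring|lra..].
- by move=> t t0; have := dG t (ltW t0) => ?; apply: ex_derive.
- have /derivable1_diffP/differentiable_continuous := @ex_derive _ _ _ _ _ _ _ (dG 0 (lexx 0)).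
  exact: cvg_at_right_filter.
- move=> t; rewrite in_itv/= andbT => /ltW t0; rewrite derive1E.
  by have := dG t t0 => ?; exact: derive_val.
Unshelve. all: by end_near. Qed.

End Laplace.

(** * Iterated Gaussian expectations *)

Section Expectation.
Context {R : realType}.
Local Notation C := (R[i]).
Local Notation mR := (measurableTypeR R).

Definition cmeasurable d (T : measurableType d) (z : T -> C) : Prop :=
  measurable_fun setT (fun t => complex.Re (z t)) /\
  measurable_fun setT (fun t => complex.Im (z t)).

(* No sigma-algebra is put on [nat -> C]: measurability is tested along every coordinatewise
   measurable family of sequences. *)
Definition vmeasurable (f : (nat -> C) -> \bar R) : Prop :=
  forall d (S : measurableType d) (u : S -> nat -> C),
    (forall k, cmeasurable (fun s => u s k)) ->
    measurable_fun setT (fun s => f (u s)).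

(** Joint measurability in a parameter and a sequence, again tested along families. The free space
    [S] lets the parameter be enlarged by coordinates that are still to be integrated. *)
Definition pmeasurable d (T : measurableType d) (F : T -> (nat -> C) -> \bar R) : Prop :=
  forall d' (S : measurableType d') (phi : S -> T) (u : S -> nat -> C),
    measurable_fun setT phi -> (forall k, cmeasurable (fun s => u s k)) ->
    measurable_fun setT (fun s => F (phi s) (u s)).

Lemma cmeasurable_scons d (S : measurableType d) (z : S -> C) (u : S -> nat -> C) :
  cmeasurable z -> (forall k, cmeasurable (fun s => u s k)) ->
  forall k, cmeasurable (fun s => scons (z s) (u s) k).
Proof. by move=> mz mu [|k] /=; [exact: mz|exact: mu]. Qed.

(** The first coordinate of the sequence moves into the parameter, as two real variables; this is
    the inductive step of the Tonelli arguments below. *)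
Lemma pmeasurable_scons d (T : measurableType d) F :
  pmeasurable F ->
  pmeasurable (fun (p : (T * mR) * mR) v => F p.1.1 (scons (p.1.2 +i* p.2)%C v)).
Proof.
move=> mF d' S phi u mphi mu; apply: mF.
  by do 2 apply: measurableT_comp => //.
apply: cmeasurable_scons => //; split => /=.
  by apply: (@measurableT_comp _ _ _ _ _ _ snd) => //; apply: measurableT_comp.
by apply: measurableT_comp.
Qed.

Lemma cgauss_expect_ge0 n (f : (nat -> C) -> \bar R) :
  (forall v, 0 <= f v)%E -> (0 <= cgauss_expect n f)%E.
Proof.
elim: n f => [|n IHn] f f0 //=.
by apply: integral_ge0 => x _; apply: integral_ge0 => y _; apply: IHn.
Qed.

(** Induction on [n]: the two real integrals of the first coordinate are partial integrals of a
    jointly measurable nonnegative function, so Tonelli gives measurability in the remaining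
    parameter. *)
Lemma measurable_cgauss_expect n d (T : measurableType d) F :
  pmeasurable F -> (forall (t : T) v, 0 <= F t v)%E ->
  measurable_fun setT (fun t => cgauss_expect n (F t)).
Proof.
elim: n d T F => [|n IHn] d T F mF F0 /=.
  by apply: (mF _ _ id) => // k; split; exact: measurable_cst.
pose f (p : (T * mR) * mR) := cgauss_expect n (fun v => F p.1.1 (scons (p.1.2 +i* p.2)%C v)).
have mf : measurable_fun setT f by apply: IHn => //; exact: pmeasurable_scons.
have f0 p : (0 <= f p)%E by exact: cgauss_expect_ge0.
have mg := measurable_fun_fubini_tonelli_F (m2 := half_gauss R) f mf f0.
apply: (measurable_fun_fubini_tonelli_F (m2 := half_gauss R) _ mg) => p.
by apply: integral_ge0.
Qed.

Section fixed_function.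
Variables (n : nat) (f : (nat -> C) -> \bar R).
Hypotheses (mf : vmeasurable f) (f0 : forall v, (0 <= f v)%E).

Let g (p : mR * mR) := cgauss_expect n (fun v => f (scons (p.1 +i* p.2)%C v)).

Lemma measurable_cgauss_expect_scons : measurable_fun setT g.
Proof.
apply: measurable_cgauss_expect => // d S phi u mphi mu.
apply: mf; apply: cmeasurable_scons => //.
by split; exact: measurableT_comp.
Qed.

Lemma measurable_cgauss_expect_scons2 x :
  measurable_fun setT (fun y : mR => cgauss_expect n (fun v => f (scons (x +i* y)%C v))).
Proof.
exact: (measurable_fun_pair2 x measurable_cgauss_expect_scons).
Qed.

Lemma measurable_cgauss_expect_scons1 :
  measurable_fun setT
    (fun x : mR => \int[half_gauss R]_y cgauss_expect n (fun v => f (scons (x +i* y)%C v)))%E.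
Proof.
apply: (measurable_fun_fubini_tonelli_F (m2 := half_gauss R) g).
  exact: measurable_cgauss_expect_scons.
by move=> p; exact: cgauss_expect_ge0.
Qed.

End fixed_function.

Lemma vmeasurable_scons f z : vmeasurable f -> vmeasurable (fun v => f (scons z v)).
Proof.
move=> mf d S u mu; apply: mf; exact: cmeasurable_scons.
Qed.

Lemma le_cgauss_expect n (f g : (nat -> C) -> \bar R) :
  vmeasurable f -> vmeasurable g -> (forall v, 0 <= f v)%E ->
  (forall v, f v <= g v)%E -> (cgauss_expect n f <= cgauss_expect n g)%E.
Proof.
elim: n f g => [|n IHn] f g mf mg f0 fg /=; first exact: fg.
have g0 v : (0 <= g v)%E by exact: le_trans (f0 v) (fg v).
apply: ge0_le_integral => //.
- by move=> x _; apply: integral_ge0 => y _; exact: cgauss_expect_ge0.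
- exact: measurable_cgauss_expect_scons1.
- exact: measurable_cgauss_expect_scons1.
move=> x _; apply: ge0_le_integral => //.
- by move=> y _; exact: cgauss_expect_ge0.
- exact: measurable_cgauss_expect_scons2.
- exact: measurable_cgauss_expect_scons2.
by move=> y _; apply: IHn => //; exact: vmeasurable_scons.
Qed.

Lemma cgauss_expectD n (f g : (nat -> C) -> \bar R) :
  vmeasurable f -> vmeasurable g -> (forall v, 0 <= f v)%E -> (forall v, 0 <= g v)%E ->
  (cgauss_expect n (fun v => f v + g v) = cgauss_expect n f + cgauss_expect n g)%E.
Proof.
elim: n f g => [//|n IHn] f g mf mg f0 g0 /=.
rewrite -ge0_integralD//; last 4 first.
- by move=> x _; apply: integral_ge0 => y _; exact: cgauss_expect_ge0.
- exact: measurable_cgauss_expect_scons1.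
- by move=> x _; apply: integral_ge0 => y _; exact: cgauss_expect_ge0.
- exact: measurable_cgauss_expect_scons1.
apply: eq_integral => x _; rewrite -ge0_integralD//; last 4 first.
- by move=> y _; exact: cgauss_expect_ge0.
- exact: measurable_cgauss_expect_scons2.
- by move=> y _; exact: cgauss_expect_ge0.
- exact: measurable_cgauss_expect_scons2.
by apply: eq_integral => y _; rewrite -IHn//; exact: vmeasurable_scons.
Qed.

Lemma cgauss_expectZl n (k : R) (f : (nat -> C) -> \bar R) : (0 <= k)%R ->
  vmeasurable f -> (forall v, 0 <= f v)%E ->
  (cgauss_expect n (fun v => k%:E * f v) = k%:E * cgauss_expect n f)%E.
Proof.
move=> k0; elim: n f => [//|n IHn] f mf f0 /=.
rewrite -ge0_integralZl//; last 2 first.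
- exact: measurable_cgauss_expect_scons1.
- by move=> x _; apply: integral_ge0 => y _; exact: cgauss_expect_ge0.
apply: eq_integral => x _; rewrite -ge0_integralZl//; last 2 first.
- exact: measurable_cgauss_expect_scons2.
- by move=> y _; exact: cgauss_expect_ge0.
by apply: eq_integral => y _; rewrite -IHn//; exact: vmeasurable_scons.
Qed.

Lemma cgauss_expect_cst n (k : \bar R) : cgauss_expect n (fun=> k) = k.
Proof.
elim: n => [//|n IHn] /=.
have cstE (r : \bar R) : (\int[half_gauss R]_x r = r)%E.
  by rewrite [LHS]integral_cst//= probability_setT mule1.
transitivity (\int[half_gauss R]_x k)%E; last exact: cstE.
by apply: eq_integral => x _; rewrite -[RHS]cstE; apply: eq_integral => y _.
Qed.

Lemma cgauss_expect_integral n d (T : measurableType d)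
    (m : {sigma_finite_measure set T -> \bar R}) F :
  pmeasurable F -> (forall t v, 0 <= F t v)%E ->
  (cgauss_expect n (fun v => \int[m]_t F t v) = \int[m]_t cgauss_expect n (F t))%E.
Proof.
move=> + F0; elim: n F F0 => [//|n IHn] F F0 mF /=.
pose f (p : (T * mR) * mR) := cgauss_expect n (fun v => F p.1.1 (scons (p.1.2 +i* p.2)%C v)).
have mf : measurable_fun setT f.
  by apply: measurable_cgauss_expect => //; exact: pmeasurable_scons.
have f0 p : (0 <= f p)%E by exact: cgauss_expect_ge0.
have mg := measurable_fun_fubini_tonelli_F (m2 := half_gauss R) f mf f0.
(* Two swaps: the integral over [m] is moved past the one in [y] at fixed [x], then past the one in
   [x]. *)
transitivity (\int[half_gauss R]_x \int[m]_t \int[half_gauss R]_y f (t, x, y))%E.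
  apply: eq_integral => x _.
  rewrite -(fubini_tonelli (fun p : mR * T => f (p.2, x, p.1))) //; last first.
    apply: (measurableT_comp mf).
    have mx : measurable_fun setT (fun p : mR * T => (p.2, x : mR)).
      by apply: measurable_fun_pair => //; exact: measurable_cst.
    by apply: measurable_fun_pair => //; exact: measurable_fst.
  apply: eq_integral => y _; rewrite IHn//.
  move=> d' S phi u mphi mu; apply: mF => //; apply: cmeasurable_scons => //.
have mh : measurable_fun setT (fun p : mR * T => \int[half_gauss R]_y f (p.2, p.1, y))%E.
  apply: (measurableT_comp mg).
  by apply: measurable_fun_pair.
apply: (fubini_tonelli _ mh).
by move=> p; exact: integral_ge0.
Qed.

Lemma cgauss_expect_integral2 n d1 d2 (T1 : measurableType d1) (T2 : measurableType d2)
    (m1 : {sigma_finite_measure set T1 -> \bar R})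
    (m2 : {sigma_finite_measure set T2 -> \bar R}) (F : T1 * T2 -> (nat -> C) -> \bar R) :
  pmeasurable F -> (forall t v, 0 <= F t v)%E ->
  (cgauss_expect n (fun v => \int[m1]_t \int[m2]_s F (t, s) v) =
   \int[m1]_t \int[m2]_s cgauss_expect n (F (t, s)))%E.
Proof.
move=> mF F0; rewrite cgauss_expect_integral; last 2 first.
- move=> d S phi u mphi mu.
  apply: (measurable_fun_fubini_tonelli_F (m2 := m2)
    (fun p : S * T2 => F (phi p.1, p.2) (u p.1))) => //.
  apply: mF => [|k].
    by apply: measurable_fun_pair => //; exact: measurableT_comp.
  have [mu1 mu2] := mu k.
  by split; [exact: (measurableT_comp mu1)|exact: (measurableT_comp mu2)].
- by move=> t v; exact: integral_ge0.
apply: eq_integral => t _; rewrite cgauss_expect_integral//.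
move=> d S phi u mphi mu; apply: mF => //.
by apply: measurable_fun_pair => //; exact: measurable_cst.
Qed.

End Expectation.

(** * Hermitian forms *)

Section Hermitian.
Context {R : realType}.
Local Notation C := (R[i]).

Lemma conj_complexE (z : C) : Num.conj z = conjc z.
Proof. by []. Qed.

Lemma cabs2E (z : C) : (cabs2 z)%:C%C = Num.conj z * z.
Proof.
by case: z => a b; rewrite conj_complexE /cabs2 /=; simpc; congr (_ +i* _)%C; ring.
Qed.

Lemma cabs2_ge0 (z : C) : 0 <= cabs2 z.
Proof. by rewrite addr_ge0// sqr_ge0. Qed.

Lemma cabs2M (z w : C) : cabs2 (z * w) = cabs2 z * cabs2 w.
Proof. by case: z => a b; case: w => c d; rewrite /cabs2 /=; ring. Qed.

Lemma cabs2_real (x : R) : cabs2 (x%:C)%C = x ^+ 2.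
Proof. by rewrite /cabs2 /= expr0n addr0. Qed.

Lemma vnorm2_ge0 m n (A : 'M[C]_(m, n)) : 0 <= vnorm2 A.
Proof. by do 2 apply: sumr_ge0 => ? _; exact: cabs2_ge0. Qed.

Lemma ctrmxK m n (A : 'M[C]_(m, n)) : ctrmx (ctrmx A) = A.
Proof. by apply/matrixP => i j; rewrite !mxE conjCK. Qed.

Lemma ctrmxM m n p (A : 'M[C]_(m, n)) (B : 'M[C]_(n, p)) :
  ctrmx (A *m B) = ctrmx B *m ctrmx A.
Proof. by rewrite /ctrmx trmx_mul map_mxM. Qed.

Lemma ctrmxD m n (A B : 'M[C]_(m, n)) : ctrmx (A + B) = ctrmx A + ctrmx B.
Proof. by apply/matrixP => i j; rewrite !mxE rmorphD. Qed.

Lemma ctrmxZ m n (a : C) (A : 'M[C]_(m, n)) : ctrmx (a *: A) = Num.conj a *: ctrmx A.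
Proof. by apply/matrixP => i j; rewrite !mxE rmorphM. Qed.

Lemma ctrmx1 n : ctrmx (1%:M : 'M[C]_n) = 1%:M.
Proof. by rewrite /ctrmx trmx1 map_mx1. Qed.

Lemma ctrmx0 m n : ctrmx (0 : 'M[C]_(m, n)) = 0.
Proof. by apply/matrixP => i j; rewrite !mxE conjC0. Qed.

Lemma ctrmx_col_mx m1 m2 n (A : 'M[C]_(m1, n)) (B : 'M[C]_(m2, n)) :
  ctrmx (col_mx A B) = row_mx (ctrmx A) (ctrmx B).
Proof. by rewrite /ctrmx tr_col_mx map_row_mx. Qed.

Lemma ctrmx_block m1 m2 n1 n2 (A : 'M[C]_(m1, n1)) (B : 'M[C]_(m1, n2))
    (D : 'M[C]_(m2, n1)) (E : 'M[C]_(m2, n2)) :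
  ctrmx (block_mx A B D E) = block_mx (ctrmx A) (ctrmx D) (ctrmx B) (ctrmx E).
Proof. by rewrite /ctrmx tr_block_mx map_block_mx. Qed.

Lemma hermsymmx_ctrmx n (A : 'M[C]_n) : A \is hermsymmx -> ctrmx A = A.
Proof. by move=> /is_hermitianmxP; rewrite expr0 scale1r => {2}->. Qed.

Lemma ctrmx_mulmx n (v : 'cV[C]_n) : (ctrmx v *m v) 0 0 = (vnorm2 v)%:C%C.
Proof.
rewrite mxE /vnorm2 rmorph_sum; apply: eq_bigr => i _.
by rewrite big_ord1 /= cabs2E !mxE.
Qed.

Lemma vnorm2_ctrmx m n (A : 'M[C]_(m, n)) : vnorm2 (ctrmx A) = vnorm2 A.
Proof.
rewrite /vnorm2 exchange_big; apply: eq_bigr => i _; apply: eq_bigr => j _.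
by rewrite !mxE; case: (A i j) => a b; rewrite conj_complexE /cabs2 /= sqrrN.
Qed.

Lemma vnorm2_col_mx m1 m2 n (A : 'M[C]_(m1, n)) (B : 'M[C]_(m2, n)) :
  vnorm2 (col_mx A B) = vnorm2 A + vnorm2 B.
Proof.
rewrite /vnorm2 big_split_ord; congr (_ + _); apply: eq_bigr => i _;
  by apply: eq_bigr => j _; rewrite (col_mxEu, col_mxEd).
Qed.

Lemma vnorm2Z m n (a : C) (A : 'M[C]_(m, n)) : vnorm2 (a *: A) = cabs2 a * vnorm2 A.
Proof.
rewrite /vnorm2 mulr_sumr; apply: eq_bigr => i _; rewrite mulr_sumr.
by apply: eq_bigr => j _; rewrite mxE cabs2M.
Qed.

Lemma vnorm2_0 m n : vnorm2 (0 : 'M[C]_(m, n)) = 0.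
Proof.
by rewrite /vnorm2 big1// => i _; rewrite big1// => j _; rewrite mxE /cabs2 expr0n addr0.
Qed.

Lemma vnorm2_11 (z : C) : vnorm2 (z%:M : 'M[C]_1) = cabs2 z.
Proof. by rewrite /vnorm2 !big_ord1 mxE eqxx mulr1n. Qed.

(** Taking the real part gives an [R]-valued form without hypotheses on [A]; for Hermitian [A]
    nothing is lost, by [ctrmx_qform]. *)
Definition qform n (A : 'M[C]_n) (v : 'cV[C]_n) : R :=
  complex.Re ((ctrmx v *m A *m v) 0 0).

Lemma ReD (z w : C) : complex.Re (z + w) = complex.Re z + complex.Re w.
Proof. by case: z; case: w. Qed.

Lemma ReZ (a : R) (z : C) : complex.Re ((a%:C)%C * z) = a * complex.Re z.
Proof. by case: z => b c /=; rewrite mul0r subr0. Qed.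

Lemma qformD n (A B : 'M[C]_n) v : qform (A + B) v = qform A v + qform B v.
Proof. by rewrite /qform mulmxDr mulmxDl mxE ReD. Qed.

Lemma qformZ n a (A : 'M[C]_n) v : qform ((a%:C)%C *: A) v = a * qform A v.
Proof. by rewrite /qform -scalemxAr -scalemxAl mxE ReZ. Qed.

Lemma qform1 n (v : 'cV[C]_n) : qform 1%:M v = vnorm2 v.
Proof. by rewrite /qform mulmx1 ctrmx_mulmx. Qed.

Lemma qform_congr n m (L : 'M[C]_(m, n)) (D : 'M[C]_m) v :
  qform (ctrmx L *m D *m L) v = qform D (L *m v).
Proof. by rewrite /qform ctrmxM !mulmxA. Qed.

Lemma qform_ctrmxM n m (L : 'M[C]_(m, n)) v : qform (ctrmx L *m L) v = vnorm2 (L *m v).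
Proof. by rewrite -qform1 -qform_congr mulmx1. Qed.

Lemma ctrmx_qform n (A : 'M[C]_n) v : ctrmx A = A ->
  (ctrmx v *m A *m v) 0 0 = ((qform A v)%:C)%C.
Proof.
move=> hA; set z := _ 0 0; have : Num.conj z = z.
  have -> : Num.conj z = ctrmx (ctrmx v *m A *m v) 0 0.
    by rewrite [RHS]mxE [X in _ = Num.conj X]mxE.
  by rewrite !ctrmxM ctrmxK hA mulmxA.
rewrite /qform -/z; case: z => a b; rewrite conj_complexE /= => -[] h.
by congr (_ +i* _)%C; lra.
Qed.

Lemma posdefmx_qform n (A : 'M[C]_n) v : ctrmx A = A -> posdefmx A -> v != 0 -> 0 < qform A v.
Proof. by move=> hA pA /pA; rewrite ctrmx_qform// ltcR. Qed.

Lemma posdefmx_ge0 n (A : 'M[C]_n) v : ctrmx A = A -> posdefmx A -> 0 <= qform A v.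
Proof.
move=> hA pA; have [->|v0] := eqVneq v 0; last exact/ltW/posdefmx_qform.
by rewrite /qform mulmx0 mxE.
Qed.

Lemma qform_gt0_posdefmx n (A : 'M[C]_n) : ctrmx A = A ->
  (forall v, v != 0 -> 0 < qform A v) -> posdefmx A.
Proof. by move=> hA pA v /pA; rewrite ctrmx_qform// ltcR. Qed.

Lemma vnorm2_gt0 m n (A : 'M[C]_(m, n)) : A != 0 -> 0 < vnorm2 A.
Proof.
move=> A0; rewrite lt_def vnorm2_ge0 andbT; apply: contra A0 => /eqP A0.
apply/eqP/matrixP => i j; rewrite mxE.
have := A0; rewrite /vnorm2 => /eqP; rewrite psumr_eq0; last first.
  by move=> *; apply: sumr_ge0 => *; exact: cabs2_ge0.
move=> /allP/(_ i (mem_index_enum _)) /=; rewrite psumr_eq0; last first.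
  by move=> *; exact: cabs2_ge0.
move=> /allP/(_ j (mem_index_enum _)) /=; rewrite /cabs2 paddr_eq0 ?sqr_ge0//.
by case: (A i j) => a b /=; rewrite !sqrf_eq0 => /andP[/eqP -> /eqP ->].
Qed.

(** * Completing the square with the Schur complement of the lower right block *)

Section Schur.
Variables (n : nat) (B : 'M[C]_(1 + n)).
Hypotheses (hB : ctrmx B = B) (pB : posdefmx B).

Let B' := drsubmx B.
Let y := dlsubmx B.

Let ctrmx_submx :
  block_mx (ctrmx (ulsubmx B)) (ctrmx y) (ctrmx (ursubmx B)) (ctrmx B') =
  block_mx (ulsubmx B) (ursubmx B) y B'.
Proof. by rewrite -ctrmx_block !submxK. Qed.

Lemma ctrmx_drsubmx : ctrmx B' = B'.
Proof. by case/eq_block_mx: ctrmx_submx. Qed.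

Lemma ctrmx_dlsubmx : ursubmx B = ctrmx y.
Proof. by case/eq_block_mx: ctrmx_submx. Qed.

(** Test [B] on vectors whose first entry is zero. *)
Lemma posdefmx_drsubmx : posdefmx B'.
Proof.
move=> v v0; have := pB (v := col_mx 0 v); rewrite ctrmx_col_mx ctrmx0.
rewrite -{1}[B]submxK mul_row_block mul_row_col !mul0mx !add0r mulmx0 add0r.
by apply; rewrite col_mx_eq0 negb_and v0 orbT.
Qed.

Hypothesis uB' : B' \in unitmx.
Let k := invmx B' *m y.
Definition schur_factor : 'M[C]_(1 + n) := block_mx 1%:M 0 k 1%:M.
Definition schur_compl : C := (ulsubmx B - ctrmx k *m B' *m k) 0 0.

Let ctrmx_kB : ctrmx k *m B' = ctrmx y.
Proof.
by rewrite -[X in _ *m X]ctrmx_drsubmx -ctrmxM /k mulKVmx.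
Qed.

Lemma schur_decomp :
  B = ctrmx schur_factor *m block_mx (schur_compl%:M) 0 0 B' *m schur_factor.
Proof.
rewrite /schur_factor ctrmx_block ctrmx0 !ctrmx1 !mulmx_block.
rewrite !(mul0mx, mulmx0, mul1mx, mulmx1, add0r, addr0).
rewrite -[LHS]submxK ctrmx_dlsubmx ctrmx_kB; congr block_mx.
  rewrite -mx11_scalar -ctrmx_kB; exact: (esym (subrK _ _)).
by rewrite /k mulKVmx.
Qed.

Lemma det_schur : \det B = schur_compl * \det B'.
Proof.
rewrite {1}schur_decomp !det_mulmx /schur_factor ctrmx_block ctrmx0 !ctrmx1.
by rewrite det_ublock !det_lblock !det1 !mul1r !mulr1 det_scalar1.
Qed.

(** [schur_factor] sends the vector (1, -k) to (1, 0), where the block diagonal form takes the value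
    [schur_compl]. *)
Lemma schur_compl_gt0 : 0 < schur_compl.
Proof.
have := pB (v := col_mx 1%:M (- k)).
rewrite {1}schur_decomp !mulmxA -ctrmxM -[_ *m schur_factor *m _]mulmxA.
have -> : schur_factor *m col_mx 1%:M (- k) = col_mx 1%:M 0.
  rewrite mul_block_col !mul1mx mul0mx addr0; congr col_mx.
  by rewrite mulmx1 subrr.
rewrite ctrmx_col_mx ctrmx1 ctrmx0 mul_row_block mul_row_col.
rewrite !(mul0mx, mulmx0, mul1mx, mulmx1, add0r, addr0) mxE eqxx mulr1n; apply.
rewrite col_mx_eq0 negb_and; apply/orP; left.
by apply/eqP => /matrixP/(_ 0 0); rewrite !mxE => /eqP; rewrite oner_eq0.
Qed.

(** The square completed in [w]: the first coordinate [z] affects the [B'] part only through a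
    translation of [w]. *)
Lemma qform_schur (z : 'M[C]_1) (w : 'cV[C]_n) :
  qform B (col_mx z w) = complex.Re schur_compl * vnorm2 z + qform B' (w + k *m z).
Proof.
rewrite {1}schur_decomp qform_congr /schur_factor mul_block_col !mul1mx mul0mx addr0.
rewrite /qform ctrmx_col_mx mul_row_block mul_row_col !mulmx0 addr0 add0r mxE ReD.
rewrite [k *m z + w]addrC; congr (_ + _).
rewrite mul_mx_scalar -scalemxAl mxE ctrmx_mulmx.
by case: schur_compl => a b /=; ring.
Qed.

End Schur.

(** The block matrix with rows (1, -x) and (y, 1) is factored into triangular blocks in two ways,
    and the determinants are compared. *)
Lemma det_rank1_update n (y : 'cV[C]_n) (x : 'rV[C]_n) :
  \det (1%:M + y *m x) = 1 + (x *m y) 0 0.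
Proof.
have e1 : block_mx 1%:M (- x) y 1%:M =
  block_mx 1%:M 0 y 1%:M *m block_mx 1%:M (- x) 0 (1%:M + y *m x) :> 'M[C]_(1 + n).
  rewrite mulmx_block !(mul0mx, mulmx0, mul1mx, mulmx1, add0r, addr0).
  by rewrite mulmxN addrC addrK.
have e2 : block_mx 1%:M (- x) y 1%:M =
  block_mx (1%:M + x *m y) (- x) 0 1%:M *m block_mx 1%:M 0 y 1%:M :> 'M[C]_(1 + n).
  rewrite mulmx_block !(mul0mx, mulmx0, mul1mx, mulmx1, add0r, addr0).
  by rewrite mulNmx addrK.
have := e2; rewrite e1 => /(congr1 determinant).
rewrite !det_mulmx !det_lblock !det_ublock !det1 !mul1r !mulr1 => ->.
by rewrite det_mx11 !mxE.
Qed.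

(** In an orthonormal eigenbasis the form is a sum of squared moduli weighted by eigenvalues, each
    at most [l]. *)
Lemma qform_eigenvalue_le n (A : 'M[C]_n) (l : C) v : A \is hermsymmx ->
  (forall a, eigenvalue A a -> a <= l) -> qform A v <= complex.Re l * vnorm2 v.
Proof.
move=> hA lP; have /orthomx_spectralP A_eq := hermitian_normalmx hA.
set P := spectralmx A in A_eq; set sp := spectral_diag A in A_eq.
have uP : P \is unitarymx := spectral_unitarymx A.
have PV : invmx P = ctrmx P := invmx_unitary uP.
have -> : vnorm2 v = vnorm2 (P *m v).
  rewrite -qform1 -qform_ctrmxM -PV mulVmx//; exact: unitarymx_unit.
rewrite A_eq PV qform_congr; move: (P *m v) => w.
rewrite /qform mxE /vnorm2 mulr_sumr.
have ReS I r (F : I -> C) : complex.Re (\sum_(i <- r) F i) = \sum_(i <- r) complex.Re (F i).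
  by elim/big_ind2: _ => // x1 x2 y1 y2 <- <-; rewrite ReD.
rewrite ReS; apply: ler_sum => i _.
rewrite big_ord1 mul_mx_diag !mxE mulrAC -cabs2E ReZ mulrC.
apply: ler_wpM2r; first exact: cabs2_ge0.
have : sp 0 i <= l.
  (* [eigenvalue] refers to row eigenvectors: the witness is a row of [P], nonzero because [P] is
     invertible. *)
  apply: lP; apply/eigenvalueP; exists (row i P).
    rewrite {1}A_eq -row_mul !mulmxA mulmxV ?unitarymx_unit// mul1mx.
    by apply/rowP => j; rewrite mul_diag_mx !mxE.
  apply/eqP => Pi0; have : row i P *m invmx P = 0 by rewrite Pi0 mul0mx.
  rewrite -row_mul mulmxV ?unitarymx_unit// => /rowP/(_ i).
  by rewrite !mxE eqxx => /eqP; rewrite oner_eq0.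
by rewrite lecE => /andP[].
Qed.

End Hermitian.

(** * The Gaussian determinant formula *)

Section ComplexMeasurability.
Context {R : realType} d (S : measurableType d).
Local Notation C := (R[i]).

Lemma cmeasurable_cst (z : C) : cmeasurable (fun _ : S => z).
Proof. by split; exact: measurable_cst. Qed.

Lemma cmeasurableD (f g : S -> C) : cmeasurable f -> cmeasurable g ->
  cmeasurable (fun s => f s + g s).
Proof.
move=> [f1 f2] [g1 g2]; split.
  by under eq_fun do rewrite ReD; exact: measurable_funD.
under eq_fun => s do have -> : complex.Im (f s + g s) = complex.Im (f s) + complex.Im (g s)
  by case: (f s); case: (g s).
exact: measurable_funD.
Qed.

Lemma cmeasurableM (f g : S -> C) : cmeasurable f -> cmeasurable g ->
  cmeasurable (fun s => f s * g s).
Proof.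
move=> [f1 f2] [g1 g2]; split.
  rewrite [X in measurable_fun _ X](_ : _ = fun s =>
    complex.Re (f s) * complex.Re (g s) - complex.Im (f s) * complex.Im (g s)).
    by apply: measurable_funB; exact: measurable_funM.
  by apply/funext => s; case: (f s); case: (g s).
rewrite [X in measurable_fun _ X](_ : _ = fun s =>
  complex.Re (f s) * complex.Im (g s) + complex.Im (f s) * complex.Re (g s)).
  by apply: measurable_funD; exact: measurable_funM.
by apply/funext => s; case: (f s); case: (g s).
Qed.

Lemma cmeasurable_sum (I : Type) (r : seq I) (f : I -> S -> C) :
  (forall i, cmeasurable (f i)) -> cmeasurable (fun s => \sum_(i <- r) f i s).
Proof.
move=> mf; elim: r => [|i r IHr].
  by under eq_fun do rewrite big_nil; exact: cmeasurable_cst.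
by under eq_fun do rewrite big_cons; exact: cmeasurableD.
Qed.

Lemma cmeasurable_conj (f : S -> C) : cmeasurable f -> cmeasurable (fun s => Num.conj (f s)).
Proof.
move=> [f1 f2]; split.
  rewrite [X in measurable_fun _ X](_ : _ = fun s => complex.Re (f s))//.
  by apply/funext => s; rewrite conj_complexE; case: (f s).
rewrite [X in measurable_fun _ X](_ : _ = fun s => - complex.Im (f s)).
  exact: measurableT_comp.
by apply/funext => s; rewrite conj_complexE; case: (f s).
Qed.

Definition mxmeasurable m n (A : S -> 'M[C]_(m, n)) : Prop :=
  forall i j, cmeasurable (fun s => A s i j).

Lemma mxmeasurable_cst m n (A : 'M[C]_(m, n)) : mxmeasurable (fun=> A).
Proof. by move=> i j; exact: cmeasurable_cst. Qed.

Lemma mxmeasurableD m n (A B : S -> 'M[C]_(m, n)) :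
  mxmeasurable A -> mxmeasurable B -> mxmeasurable (fun s => A s + B s).
Proof. by move=> mA mB i j; under eq_fun do rewrite mxE; exact: cmeasurableD. Qed.

Lemma mxmeasurableM m n p (A : S -> 'M[C]_(m, n)) (B : S -> 'M[C]_(n, p)) :
  mxmeasurable A -> mxmeasurable B -> mxmeasurable (fun s => A s *m B s).
Proof.
move=> mA mB i j; under eq_fun do rewrite mxE.
by apply: cmeasurable_sum => k; exact: cmeasurableM.
Qed.

Lemma mxmeasurable_ctrmx m n (A : S -> 'M[C]_(m, n)) :
  mxmeasurable A -> mxmeasurable (fun s => ctrmx (A s)).
Proof. by move=> mA i j; under eq_fun do rewrite !mxE; exact: cmeasurable_conj. Qed.

Lemma measurable_cabs2 (f : S -> C) : cmeasurable f -> measurable_fun setT (fun s => cabs2 (f s)).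
Proof. by move=> [f1 f2]; apply: measurable_funD; exact: measurable_funX. Qed.

Lemma measurable_vnorm2 m n (A : S -> 'M[C]_(m, n)) :
  mxmeasurable A -> measurable_fun setT (fun s => vnorm2 (A s)).
Proof.
move=> mA; rewrite /vnorm2; apply: measurable_sum => i.
by apply: measurable_sum => j; apply: measurable_cabs2; exact: mA.
Qed.

Lemma measurable_qform n (A : 'M[C]_n) (v : S -> 'cV[C]_n) :
  mxmeasurable v -> measurable_fun setT (fun s => qform A (v s)).
Proof.
move=> mv; have mw : mxmeasurable (fun s => ctrmx (v s) *m A *m v s).
  apply: mxmeasurableM => //; apply: mxmeasurableM; last exact: mxmeasurable_cst.
  exact: mxmeasurable_ctrmx.
by have [] := mw 0 0.
Qed.

End ComplexMeasurability.

(** * The Gaussian integral of a Hermitian form, by induction on the dimension *)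

Section GaussianIntegral.
Context {R : realType}.
Local Notation C := (R[i]).

Lemma mxmeasurable_col n d (S : measurableType d) (u : S -> nat -> C) :
  (forall k, cmeasurable (fun s => u s k)) -> mxmeasurable (fun s => \col_(i < n) u s i).
Proof. by move=> mu i j; under eq_fun do rewrite mxE; exact: mu. Qed.

Lemma col_scons n (z : C) (v : nat -> C) :
  (\col_(i < n.+1) scons z v i) = col_mx (z%:M : 'M[C]_1) (\col_(i < n) v i).
Proof.
apply/matrixP => i j; rewrite ord1 !mxE; case: splitP => k ik; rewrite !mxE.
  by rewrite ik ord1 eqxx mulr1n.
by rewrite ik.
Qed.

(** The integrand factors over real and imaginary parts, and each one-dimensional integral gives
    1/sqrt(s). *)
Lemma integral_half_gauss2 (s k a b : R) : 0 < s -> 0 <= k ->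
  (\int[half_gauss R]_x \int[half_gauss R]_y
    ((expR (cabs2 (x +i* y)%C) * expR (- (s * cabs2 ((x +i* y) + (a +i* b))%C)))%:E * k%:E))%E
  = (s^-1 * k)%:E.
Proof.
move=> s0 k0.
have mg (c : R) : measurable_fun setT
    (fun x : measurableTypeR R => (expR (x ^+ 2) * expR (- (s * (x + c) ^+ 2)))%:E).
  apply/measurable_EFinP; apply: measurable_funM; apply: measurableT_comp => //.
  apply: measurableT_comp => //; apply: measurable_funM => //.
  by apply: measurable_funX; exact: measurable_funD.
have g0 (c x : R) : (0 <= (expR (x ^+ 2) * expR (- (s * (x + c) ^+ 2)))%:E)%E.
  by rewrite lee_fin mulr_ge0 ?expR_ge0.
transitivity (\int[half_gauss R]_x ((expR (x ^+ 2) * expR (- (s * (x + a) ^+ 2)))%:E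
   * ((Num.sqrt s)^-1 * k)%:E))%E.
  apply: eq_integral => x _; rewrite [(Num.sqrt s)^-1 * k]mulrC [(k * _)%:E]EFinM muleA.
  rewrite -(integral_half_gauss b s0).
  rewrite -ge0_integralZl//; last by rewrite mule_ge0 ?lee_fin.
  apply: eq_integral => y _; rewrite -!EFinM; congr EFin.
  by rewrite /cabs2 /= expRD mulrDr opprD expRD; ring.
rewrite ge0_integralZr//; last by rewrite lee_fin mulr_ge0 ?invr_ge0.
by rewrite integral_half_gauss// -EFinM mulrA -invfM -expr2 sqr_sqrtr ?ltW.
Qed.

Lemma vmeasurable_gauss n (B : 'M[C]_n) c :
  vmeasurable (fun v => (expR (vnorm2 (\col_(i < n) v i)) *
                         expR (- qform B (\col_(i < n) v i + c)))%:E).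
Proof.
move=> d S u mu; apply/measurable_EFinP; have mc := mxmeasurable_col (n := n) mu.
apply: measurable_funM; apply: measurableT_comp => //; first exact: measurable_vnorm2.
apply: measurableT_comp => //; apply: measurable_qform.
by apply: mxmeasurableD => //; exact: mxmeasurable_cst.
Qed.

(* The factor [expR (vnorm2 v)] cancels the Gaussian weight, so that the integral is translation
   invariant; this makes completing the square by the Schur complement an induction on [n]. *)
Lemma cgauss_expect_shifted n (B : 'M[C]_n) : ctrmx B = B -> posdefmx B ->
  0 < \det B /\
  forall c, cgauss_expect n (fun v => (expR (vnorm2 (\col_(i < n) v i)) *
                         expR (- qform B (\col_(i < n) v i + c)))%:E)
            = ((complex.Re (\det B))^-1)%:E.
Proof.
elim: n B => [|n IHn] B hB pB.
  rewrite det_mx00; split=> [|c]; first exact: ltr01.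
  rewrite /= invr1 /vnorm2 big_ord0 expR0 mul1r /qform.
  by rewrite [X in complex.Re X]mxE big_ord0 /= oppr0 expR0.
have [d'0 IH] := IHn _ (ctrmx_drsubmx hB) (posdefmx_drsubmx pB).
have uB' : drsubmx (B : 'M[C]_(1 + n)) \in unitmx.
  by rewrite unitmxE unitfE gt_eqF.
have s0 := schur_compl_gt0 hB pB uB'.
have detB := det_schur hB uB'.
split=> [|c]; first by rewrite detB mulr_gt0.
have Re_gt0 (z : C) : 0 < z -> (z = (complex.Re z)%:C%C) /\ 0 < complex.Re z.
  by case: z => a b; rewrite ltcE /= => /andP[/eqP -> ?].
have [sE sr0] := Re_gt0 _ s0; have [dE dr0] := Re_gt0 _ d'0.
set s := complex.Re _ in sE sr0; set d' := complex.Re _ in dE dr0.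
have -> : complex.Re (\det B) = s * d' by rewrite detB sE ReZ.
pose c0 := (usubmx (c : 'cV[C]_(1 + n))) 0 0; pose c' := dsubmx (c : 'cV[C]_(1 + n)).
have cE : c = col_mx (c0%:M : 'M[C]_1) c' by rewrite -mx11_scalar vsubmxK.
pose k := invmx (drsubmx (B : 'M[C]_(1 + n))) *m dlsubmx (B : 'M[C]_(1 + n)).
rewrite /=.
transitivity (\int[half_gauss R]_x \int[half_gauss R]_y
    ((expR (cabs2 (x +i* y)%C) * expR (- (s * cabs2 ((x +i* y) + c0)%C)))%:E * (d'^-1)%:E))%E.
  apply: eq_integral => x _; apply: eq_integral => y _.
  set z := (x +i* y)%C.
  (* The induction hypothesis is used at a shift that depends on the outer variable [z]; its value
     does not, so it leaves the outer integral as the constant [d'^-1]. *)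
  rewrite -(IH (c' + k *m (z + c0)%:M)) -cgauss_expectZl; last 3 first.
  - by rewrite mulr_ge0 ?expR_ge0.
  - exact: vmeasurable_gauss.
  - by move=> v; rewrite lee_fin mulr_ge0 ?expR_ge0.
  congr cgauss_expect; apply/funext => v; rewrite -EFinM; congr EFin.
  rewrite col_scons (vnorm2_col_mx (z%:M : 'M[C]_1) (\col_(i < n) v i)) vnorm2_11 cE.
  have -> : col_mx z%:M (\col_(i < n) v i) + col_mx c0%:M c' =
            col_mx ((z + c0)%:M : 'M[C]_1) (\col_(i < n) v i + c').
    by rewrite add_col_mx -raddfD.
  rewrite (qform_schur hB uB') vnorm2_11 -/s -/k.
  rewrite -[\col_(i < n) v i + c' + _]addrA.
  move: (cabs2 z) (cabs2 _) (vnorm2 _) (qform _ _) => e1 e2 e3 e4.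
  by rewrite opprD !expRD; ring.
case: (c0) => a b; rewrite integral_half_gauss2//; last by rewrite invr_ge0 ltW.
by rewrite invfM.
Qed.

(** The shifted formula for [1%:M + A] at shift 0: the identity part of the form cancels the factor
    [expR (vnorm2 v)]. Adding the identity makes a semidefinite [A] definite. *)
Lemma cgauss_expect_qform n (A : 'M[C]_n) : ctrmx A = A -> (forall v, 0 <= qform A v) ->
  cgauss_expect n (fun v => (expR (- qform A (\col_(i < n) v i)))%:E)
  = ((complex.Re (\det (1%:M + A)))^-1)%:E.
Proof.
move=> hA pA; have hB : ctrmx (1%:M + A) = 1%:M + A by rewrite ctrmxD ctrmx1 hA.
have pB : posdefmx (1%:M + A).
  by apply: qform_gt0_posdefmx => // v v0; rewrite qformD qform1 ltr_pwDl// vnorm2_gt0.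
rewrite -((cgauss_expect_shifted hB pB).2 0).
congr cgauss_expect; apply/funext => v; congr EFin.
by rewrite addr0 -expRD qformD qform1; congr expR; ring.
Qed.

End GaussianIntegral.

(** * Splitting and exchanging the expectations over the two channels *)

Section IteratedExpectation.
Context {R : realType}.
Local Notation C := (R[i]).
Local Notation mR := (measurableTypeR R).

Definition vvmeasurable (F : (nat -> C) -> (nat -> C) -> \bar R) : Prop :=
  forall d (S : measurableType d) (u v : S -> nat -> C),
    (forall k, cmeasurable (fun s => u s k)) ->
    (forall k, cmeasurable (fun s => v s k)) ->
    measurable_fun setT (fun s => F (u s) (v s)).

Lemma cmeasurable_comp d1 d2 (S1 : measurableType d1) (S2 : measurableType d2)
    (f : S2 -> C) (g : S1 -> S2) :
  cmeasurable f -> measurable_fun setT g -> cmeasurable (fun s => f (g s)).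
Proof.
move=> [f1 f2] mg.
by split; [exact: (measurableT_comp f1 mg)|exact: (measurableT_comp f2 mg)].
Qed.

Lemma vvmeasurable_flip F : vvmeasurable F -> vvmeasurable (fun v w => F w v).
Proof. by move=> mF d S u v mu mv; exact: mF. Qed.

Lemma vmeasurable_cgauss_expect n F : vvmeasurable F -> (forall v w, 0 <= F v w)%E ->
  vmeasurable (fun v => cgauss_expect n (F v)).
Proof.
move=> mF F0 d S u mu; apply: measurable_cgauss_expect => // d' S' phi u' mphi mu'.
by apply: mF => // k; exact: (cmeasurable_comp (mu k) mphi).
Qed.

(** The second block is peeled off one coordinate at a time; each of its real integrals is moved
    past the whole first block by [cgauss_expect_integral]. *)
Lemma cgauss_expect_swap n m F : vvmeasurable F -> (forall v w, 0 <= F v w)%E ->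
  cgauss_expect n (fun v => cgauss_expect m (F v)) =
  cgauss_expect m (fun w => cgauss_expect n (fun v => F v w)).
Proof.
elim: m F => [//|m IHm] F mF F0 /=.
have msc d (S : measurableType d) (u : S -> nat -> C) (z : S -> C) :
    (forall k, cmeasurable (fun s => u s k)) -> cmeasurable z ->
    measurable_fun setT (fun s => cgauss_expect m (fun w => F (u s) (scons (z s) w))).
  move=> mu mz; apply: measurable_cgauss_expect => // d' S' phi u' mphi mu'.
  apply: mF => [k|]; first exact: (cmeasurable_comp (mu k) mphi).
  by apply: cmeasurable_scons => //; exact: (cmeasurable_comp mz mphi).
rewrite cgauss_expect_integral; last 2 first.
- move=> d S phi u mphi mu.
  apply: (measurable_fun_fubini_tonelli_F (m2 := half_gauss R)
    (fun p : S * mR => cgauss_expect m (fun w => F (u p.1) (scons (phi p.1 +i* p.2)%C w)))).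
    apply: msc => [k|]; first exact: (cmeasurable_comp (mu k) measurable_fst).
    by split => //=; exact: measurableT_comp.
  by move=> p; exact: cgauss_expect_ge0.
- by move=> x v; apply: integral_ge0 => y _; exact: cgauss_expect_ge0.
apply: eq_integral => x _; rewrite cgauss_expect_integral; last 2 first.
- by move=> d S phi u mphi mu; apply: msc => //; split => //=; exact: measurable_cst.
- by move=> y v; exact: cgauss_expect_ge0.
apply: eq_integral => y _; rewrite IHm// => d S u v mu mv.
apply: mF => //; apply: cmeasurable_scons => //; exact: cmeasurable_cst.
Qed.

Lemma cgauss_expect_add n m (f : (nat -> C) -> \bar R) :
  cgauss_expect (n + m) f = cgauss_expect n (fun v => cgauss_expect m (fun w =>
    f (fun k => if (k < n)%N then v k else w (k - n)%N))).
Proof.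
elim: n f => [|n IHn] f.
  by congr cgauss_expect; apply/funext => w; congr f; apply/funext => k; rewrite subn0.
rewrite addSn /=; apply: eq_integral => x _; apply: eq_integral => y _; rewrite IHn.
congr cgauss_expect; apply/funext => v; congr cgauss_expect; apply/funext => w.
by congr f; apply/funext => -[|k].
Qed.

Lemma channel_expectE n (f : 'cV[C]_n -> 'rV[C]_n -> \bar R) :
  channel_expect f =
  cgauss_expect n (fun v => cgauss_expect n (fun w => f (\col_i v i) (\row_i w i))).
Proof.
rewrite /channel_expect cgauss_expect_add; congr cgauss_expect; apply/funext => v.
congr cgauss_expect; apply/funext => w; congr f; apply/matrixP => i j; rewrite !mxE.
  by rewrite ltn_ord.
by rewrite ltnNge leq_addr addKn.
Qed.

Lemma mxmeasurable_row n k d (S : measurableType d) (u : S -> nat -> C) :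
  (forall k, cmeasurable (fun s => u s k)) -> mxmeasurable (fun s => \row_(i < n) u s (k + i)%N).
Proof. by move=> mu i j; under eq_fun do rewrite mxE; exact: mu. Qed.

End IteratedExpectation.

(** * The logarithm as an integral over the whole plane *)

Section LaplaceWeight.
Context {R : realType}.
Local Notation mR := (measurableTypeR R).
Local Notation mu := (@lebesgue_measure R).

(** The pair is (t, s). The indicators move the restriction to the quadrant into the integrand, so
    that Tonelli applies to total functions. *)
Definition laplace_weight (p : mR * mR) : R :=
  \1_(`[0, +oo[ : set R) p.1 * \1_(`[0, +oo[ : set R) p.2 * expR (- (p.2 * (1 + p.1))).

Lemma laplace_weight_ge0 p : 0 <= laplace_weight p.
Proof. by rewrite !mulr_ge0 ?expR_ge0. Qed.

Lemma measurable_laplace_weight : measurable_fun setT laplace_weight.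
Proof.
apply: measurable_funM; first apply: measurable_funM.
- by apply: measurableT_comp => //; exact: measurable_indic.
- by apply: measurableT_comp => //; exact: measurable_indic.
apply: measurableT_comp => //; apply: measurableT_comp => //.
by apply: measurable_funM => //; exact: measurable_funD.
Qed.

Lemma measurable_laplace_kernel d (S : measurableType d) (x y s : S -> R) :
  measurable_fun setT x -> measurable_fun setT y -> measurable_fun setT s ->
  measurable_fun setT (fun t => laplace_kernel (x t) (y t) (s t)).
Proof.
move=> mx my ms; apply: measurable_funM; apply: measurable_funB => //;
  apply: measurableT_comp => //; apply: measurableT_comp => //; exact: measurable_funM.
Qed.

Lemma ln_laplace_weight (x y : R) : 0 <= x -> 0 <= y ->
  (\int[mu]_t \int[mu]_s (laplace_weight (t, s) * laplace_kernel x y s)%:E)%E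
  = (ln (1 + x * y / (x + y + 1)))%:E.
Proof.
move=> x0 y0; rewrite -(ln_laplace x0 y0) [RHS]integral_mkcond; apply: eq_integral => t _.
rewrite patchE /laplace_weight /= indicE; case: ifPn => _; last first.
  by apply: integral0_eq => s _; rewrite !mul0r.
rewrite [RHS]integral_mkcond; apply: eq_integral => s _.
rewrite patchE indicE; case: ifPn => _; first by rewrite !mul1r.
by rewrite mulr0 !mul0r.
Qed.

End LaplaceWeight.

(** * Expectation of the kernel for a fixed second hop *)

Section KernelExpectation.
Context {R : realType} (n : nat).
Local Notation C := (R[i]).
Variables (A : 'M[C]_n).
Hypotheses (hA : ctrmx A = A) (pA : forall v, 0 <= qform A v).

Local Notation col v := (\col_(i < n) v i).

Definition pencil (p : R) : 'M[C]_n := 1%:M + (p%:C)%C *: A.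

Lemma ctrmx_pencil p : ctrmx (pencil p) = pencil p.
Proof.
rewrite /pencil ctrmxD ctrmx1 ctrmxZ hA; congr (_ + _ *: _).
by rewrite conj_complexE /= oppr0.
Qed.

Lemma qform_pencil p v : qform (pencil p) v = vnorm2 v + p * qform A v.
Proof. by rewrite qformD qformZ qform1. Qed.

Lemma posdefmx_pencil p : 0 <= p -> posdefmx (pencil p).
Proof.
move=> p0; apply: qform_gt0_posdefmx => [|v v0]; first exact: ctrmx_pencil.
by rewrite qform_pencil ltr_pwDl ?vnorm2_gt0// mulr_ge0.
Qed.

(** Positivity of the determinant is the first half of [cgauss_expect_shifted], where it is proved
    along with the integral. *)
Lemma det_pencil p : 0 <= p -> 0 < complex.Re (\det (pencil p)) /\
  \det (pencil p) = ((complex.Re (\det (pencil p)))%:C)%C.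
Proof.
move=> p0; have [+ _] := cgauss_expect_shifted (ctrmx_pencil p) (posdefmx_pencil p0).
by case: (\det _) => a b; rewrite ltcE /= => /andP[/eqP ->].
Qed.

Lemma unitmx_pencil p : 0 <= p -> pencil p \in unitmx.
Proof.
move=> /det_pencil[d0 dE]; rewrite unitmxE unitfE dE.
by apply/eqP => -[] /eqP; rewrite gt_eqF.
Qed.

Lemma pencil0 : pencil 0 = 1%:M.
Proof. by rewrite /pencil scale0r addr0. Qed.

Lemma cabs2_qform (L : 'rV[C]_n) v : cabs2 ((L *m v) 0 0) = qform (ctrmx L *m L) v.
Proof. by rewrite qform_ctrmxM /vnorm2 !big_ord1. Qed.

(** The exponent is the form of [B] = pA + q L^H L, and 1 + B = (1 + pA)(1 + q (1 + pA)^-1 L^H L),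
    whose second factor is a rank-one update of the identity. *)
Lemma cgauss_expect_exp2 (L : 'rV[C]_n) (p q : R) : 0 <= p -> 0 <= q ->
  cgauss_expect n (fun v => (expR (- (p * qform A (col v))) *
                             expR (- (q * cabs2 ((L *m col v) 0 0))))%:E)
  = ((complex.Re (\det (pencil p)) *
      (1 + q * qform (invmx (pencil p)) (ctrmx L)))^-1)%:E.
Proof.
move=> p0 q0; pose B := (p%:C)%C *: A + (q%:C)%C *: (ctrmx L *m L).
have BE v : qform B v = p * qform A v + q * cabs2 ((L *m v) 0 0).
  by rewrite qformD !qformZ cabs2_qform.
have hB : ctrmx B = B.
  rewrite ctrmxD !ctrmxZ ctrmxM ctrmxK hA; congr (_ *: _ + _ *: _);
  by rewrite conj_complexE /= oppr0.
have B0 v : 0 <= qform B v.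
  by rewrite BE addr_ge0// mulr_ge0// cabs2_ge0.
transitivity (cgauss_expect n (fun v => (expR (- qform B (col v)))%:E)).
  by congr cgauss_expect; apply/funext => v; rewrite BE opprD expRD.
rewrite cgauss_expect_qform//; congr ((_ ^-1)%:E).
have [d0 dE] := det_pencil p0; have uM := unitmx_pencil p0.
have -> : 1%:M + B = pencil p *m (1%:M + ((q%:C)%C *: (invmx (pencil p) *m ctrmx L)) *m L).
  by rewrite mulmxDr mulmx1 -scalemxAl -scalemxAr !mulmxA (mulmxV uM) mul1mx addrA.
rewrite det_mulmx det_rank1_update dE ReZ; congr (_ * _).
by rewrite ReD -scalemxAr mxE ReZ /qform ctrmxK mulmxA.
Qed.

Lemma cgauss_expect_kernel (L : 'rV[C]_n) (p q : R) : 0 <= p -> 0 <= q ->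
  let D := complex.Re (\det (pencil p)) in
  cgauss_expect n (fun v => ((1 - expR (- (p * qform A (col v)))) *
                             (1 - expR (- (q * cabs2 ((L *m col v) 0 0)))))%:E)
  = (1 + (D * (1 + q * qform (invmx (pencil p)) (ctrmx L)))^-1
     - (D^-1 + (1 + q * vnorm2 L)^-1))%:E.
Proof.
move=> p0 q0 D.
have eA : cgauss_expect n (fun v => (expR (- (p * qform A (col v))))%:E) = (D^-1)%:E.
  have := cgauss_expect_exp2 L p0 (lexx 0); rewrite mul0r addr0 mulr1 => <-.
  by congr cgauss_expect; apply/funext => v; rewrite mul0r oppr0 expR0 mulr1.
have eB : cgauss_expect n (fun v => (expR (- (q * cabs2 ((L *m col v) 0 0))))%:E)
          = ((1 + q * vnorm2 L)^-1)%:E.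
  have := cgauss_expect_exp2 L (lexx 0) q0.
  rewrite pencil0 det1 invmx1 qform1 vnorm2_ctrmx mul1r => <-.
  by congr cgauss_expect; apply/funext => v; rewrite mul0r oppr0 expR0 mul1r.
have eAB := cgauss_expect_exp2 L p0 q0.
set X := LHS.
have mA : vmeasurable (fun v => (expR (- (p * qform A (col v))))%:E).
  move=> d S u mu; apply/measurable_EFinP; apply: measurableT_comp => //.
  apply: measurableT_comp => //; apply: measurable_funM => //.
  by apply: measurable_qform; exact: mxmeasurable_col.
have mB : vmeasurable (fun v => (expR (- (q * cabs2 ((L *m col v) 0 0))))%:E).
  move=> d S u mu; apply/measurable_EFinP; apply: measurableT_comp => //.
  apply: measurableT_comp => //; apply: measurable_funM => //; apply: measurable_cabs2.
  have mL : mxmeasurable (fun s => L *m col (u s)).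
    by apply: mxmeasurableM; [exact: mxmeasurable_cst|exact: mxmeasurable_col].
  exact: mL.
have mAB : vmeasurable (fun v => (expR (- (p * qform A (col v))) *
                             expR (- (q * cabs2 ((L *m col v) 0 0))))%:E).
  move=> d S u mu; apply/measurable_EFinP; apply: measurable_funM.
    by apply/measurable_EFinP; exact: mA.
  by apply/measurable_EFinP; exact: mB.
have mX : vmeasurable (fun v => ((1 - expR (- (p * qform A (col v)))) *
                             (1 - expR (- (q * cabs2 ((L *m col v) 0 0)))))%:E).
  move=> d S u mu; apply/measurable_EFinP; apply: measurable_funM;
  apply: measurable_funB => //; apply/measurable_EFinP; [exact: mA|exact: mB].
(* The subtracted terms are moved to the other side, so that additivity for nonnegative functions
   suffices; finiteness of [X] then follows from the finite right-hand side. *)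
have : (X + (D^-1 + (1 + q * vnorm2 L)^-1)%:E =
  (1 + (D * (1 + q * qform (invmx (pencil p)) (ctrmx L)))^-1)%:E)%E.
  rewrite !EFinD -eA -eB -eAB /X -(cgauss_expect_cst n 1%:E).
  have mS : vmeasurable (fun v => (expR (- (p * qform A (col v))))%:E +
       (expR (- (q * cabs2 ((L *m col v) 0 0))))%:E)%E.
    by move=> d S u mu; apply: emeasurable_funD; [exact: mA|exact: mB].
  rewrite -!cgauss_expectD//.
  - by congr cgauss_expect; apply/funext => v; rewrite -!EFinD; congr EFin; ring.
  all: try by move=> v; rewrite ?lee_fin ?adde_ge0 ?lee_fin ?mulr_ge0 ?expR_ge0.
  - by move=> v; rewrite lee_fin mulr_ge0// one_subr_exp_ge0// mulr_ge0// cabs2_ge0.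
by case: X => [r| |]//; rewrite -EFinD => -[] h; congr EFin; lra.
Qed.

End KernelExpectation.

(** * Optimality of the top eigenvector *)

Section TopEigenvector.
Context {R : realType} (n : nat).
Local Notation C := (R[i]).
Variables (A S : 'M[C]_n) (lam : C) (u : 'cV[C]_n).
Hypotheses (hA : A \is hermsymmx) (pA : posdefmx A).
Hypotheses (hS : S \is hermsymmx) (SSA : S *m S = A).
Hypotheses (lamP : forall l, eigenvalue A l -> l <= lam).
Hypotheses (Au : A *m u = lam *: u) (u1 : vnorm2 u = 1).

Local Notation col v := (\col_(i < n) v i).
Let l := complex.Re lam.

Let cA : ctrmx A = A. Proof. exact: hermsymmx_ctrmx. Qed.
Let cS : ctrmx S = S. Proof. exact: hermsymmx_ctrmx. Qed.

Let qA0 v : 0 <= qform A v. Proof. exact: posdefmx_ge0. Qed.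

Lemma qform_le_top v : qform A v <= l * vnorm2 v.
Proof. exact: qform_eigenvalue_le. Qed.

Lemma vnorm2_root v : vnorm2 (S *m v) = qform A v.
Proof. by rewrite -qform_ctrmxM cS SSA. Qed.

Lemma vnorm2_row_root (w : 'rV[C]_n) : vnorm2 (w *m S) = qform A (ctrmx w).
Proof. by rewrite -vnorm2_ctrmx ctrmxM cS vnorm2_root. Qed.

(** Since [u] is a unit vector, u^H A u = [lam]; a Hermitian form is real valued. *)
Lemma top_eigenvalueE : lam = (l%:C)%C /\ qform A u = l.
Proof.
have := ctrmx_qform u cA; rewrite -mulmxA Au -scalemxAr mxE ctrmx_mulmx u1 mulr1 /l => ->.
by [].
Qed.

Lemma top_eigenvalue_gt0 : 0 < l.
Proof.
have [_ <-] := top_eigenvalueE; apply: posdefmx_qform => //.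
apply/eqP => u0; by have /eqP := u1; rewrite u0 vnorm2_0 eq_sym oner_eq0.
Qed.

(* With [x = (1 + p A)^-1 y] this is [x^H (1 + p A)^2 x <= (1 + p l) x^H (1 + p A) x]. *)
Lemma qform_inv_pencil_ge p y : 0 <= p ->
  vnorm2 y <= (1 + p * l) * qform (invmx (pencil A p)) y.
Proof.
move=> p0; have uM := unitmx_pencil cA qA0 p0.
set M := pencil A p in uM *; have cM : ctrmx M = M by exact: ctrmx_pencil.
rewrite -[y](mulKVmx uM) -/M; move: (invmx M *m y) => x.
have -> : qform (invmx M) (M *m x) = qform M x.
  by rewrite -qform_congr cM (mulmxV uM) mul1mx.
rewrite -qform_ctrmxM cM /M qform_pencil.
have -> : qform (pencil A p *m pencil A p) x =
    vnorm2 x + p * qform A x + (p * qform A x + p * (p * qform A (S *m x))).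
  (* The A^2 term is written S^H A S, so that the eigenvalue bound at [S *m x] yields x^H A^2 x <= l
     x^H A x. *)
  have -> : pencil A p *m pencil A p = pencil A p + ((p%:C)%C *: A +
      (p%:C)%C *: ((p%:C)%C *: (ctrmx S *m A *m S))).
    rewrite {1}/pencil mulmxDl mul1mx; congr (_ + _).
    rewrite -scalemxAl /pencil mulmxDr mulmx1 scalerDr; congr (_ + _ *: _).
    by rewrite -scalemxAr cS -SSA !mulmxA.
  by rewrite qformD qform_pencil qformD !qformZ qform_congr.
have h1 := qform_le_top x.
have h2 := qform_le_top (S *m x); rewrite vnorm2_root in h2.
have h3 := ler_wpM2l p0 h1; have h4 := ler_wpM2l p0 (ler_wpM2l p0 h2).
lra.
Qed.

(** As [S] commutes with [A], [S *m u] is again a top eigenvector, of squared norm [l], and the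
    inverse pencil divides it by 1 + pl. This is the equality case of [qform_inv_pencil_ge]. *)
Lemma qform_inv_pencil_top p : 0 <= p ->
  qform (invmx (pencil A p)) (S *m u) = l / (1 + p * l).
Proof.
move=> p0; have uM := unitmx_pencil cA qA0 p0; have l0 := top_eigenvalue_gt0.
have [lamE ul] := top_eigenvalueE.
have d0 : 1 + p * l != 0 by rewrite gt_eqF// ltr_pwDl// mulr_ge0// ltW.
have e : pencil A p *m (S *m u) = ((1 + p * l)%:C)%C *: (S *m u).
  rewrite /pencil mulmxDl mul1mx -scalemxAl -{1}SSA -mulmxA [S *m (S *m u)]mulmxA SSA Au.
  rewrite -scalemxAr scalerA lamE -rmorphM /= rmorphD /= rmorph1.
  by rewrite scalerDl scale1r.
have ei : invmx (pencil A p) *m (S *m u) = (((1 + p * l)^-1)%:C)%C *: (S *m u).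
  apply: (can_inj (mulKmx uM)); rewrite mulKVmx// -scalemxAr e scalerA -rmorphM /=.
  by rewrite mulVf// scale1r.
rewrite /qform -mulmxA ei -scalemxAr mxE ReZ ctrmx_mulmx /= vnorm2_root ul; ring.
Qed.

(** The kernel with the second hop fixed: [p] stands for s k1 |h_2 w_t|^2 and [q] for s k2. *)
Definition receive_kernel p q (w : 'rV[C]_n) (h : 'cV[C]_n) : R :=
  (1 - expR (- (p * vnorm2 (S *m h)))) * (1 - expR (- (q * cabs2 ((w *m (S *m h)) 0 0)))).

Lemma cgauss_expect_receive_kernel p q w : 0 <= p -> 0 <= q ->
  let D := complex.Re (\det (pencil A p)) in
  cgauss_expect n (fun v => (receive_kernel p q w (col v))%:E) =
  (1 + (D * (1 + q * qform (invmx (pencil A p)) (S *m ctrmx w)))^-1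
     - (D^-1 + (1 + q * qform A (ctrmx w))^-1))%:E.
Proof.
move=> p0 q0 D; rewrite -vnorm2_row_root -[S in S *m ctrmx w]cS -ctrmxM.
rewrite -(cgauss_expect_kernel cA qA0 (w *m S) p0 q0).
apply: (congr1 (cgauss_expect n)); apply/funext => v.
by rewrite /receive_kernel vnorm2_root mulmxA.
Qed.

Lemma vmeasurable_receive_kernel p q w :
  vmeasurable (fun v => (receive_kernel p q w (col v))%:E).
Proof.
move=> d T v mv; apply/measurable_EFinP.
have mSv : mxmeasurable (fun t => S *m col (v t)).
  by apply: mxmeasurableM; [exact: mxmeasurable_cst|exact: mxmeasurable_col].
have mwv : mxmeasurable (fun t => w *m (S *m col (v t))).
  by apply: mxmeasurableM => //; exact: mxmeasurable_cst.
apply: measurable_funM; apply: measurable_funB => //; apply: measurableT_comp => //;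
  apply: measurableT_comp => //; apply: measurable_funM => //.
  exact: measurable_vnorm2.
by apply: measurable_cabs2; exact: mwv.
Qed.

Lemma receive_kernel_ge0 p q w h : 0 <= p -> 0 <= q -> 0 <= receive_kernel p q w h.
Proof.
by move=> p0 q0; rewrite mulr_ge0// one_subr_exp_ge0// mulr_ge0// ?vnorm2_ge0 ?cabs2_ge0.
Qed.

Lemma receive_optimal p q w : 0 <= p -> 0 <= q -> vnorm2 w = 1 ->
  (cgauss_expect n (fun v => (receive_kernel p q w (col v))%:E) <=
   cgauss_expect n (fun v => (receive_kernel p q (ctrmx u) (col v))%:E))%E.
Proof.
move=> p0 q0 w1; have l0 := top_eigenvalue_gt0; have [lamE ul] := top_eigenvalueE.
pose x := qform A (ctrmx w).
have x0 : 0 < x.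
  apply: posdefmx_qform => //; apply/eqP => w0.
  by have /eqP := w1; rewrite -vnorm2_ctrmx w0 vnorm2_0 eq_sym oner_eq0.
have xl : x <= l by have := qform_le_top (ctrmx w); rewrite vnorm2_ctrmx w1 mulr1.
(* Rescaling [w] so that [w A w^H = l] only increases the kernel. *)
pose g := Num.sqrt (l / x); have g2 : g ^+ 2 = l / x by rewrite sqr_sqrtr// ltW// divr_gt0.
have g1 : 1 <= g ^+ 2 by rewrite g2 ler_pdivlMr// mul1r.
pose w' := (g%:C)%C *: w.
have w'E : qform A (ctrmx w') = l.
  rewrite -vnorm2_row_root /w' -scalemxAl vnorm2Z vnorm2_row_root cabs2_real g2 -/x.
  by rewrite divfK// gt_eqF.
apply: (@le_trans _ _ (cgauss_expect n (fun v => (receive_kernel p q w' (col v))%:E))).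
  apply: le_cgauss_expect; try exact: vmeasurable_receive_kernel.
    by move=> v; rewrite lee_fin receive_kernel_ge0.
  move=> v; rewrite lee_fin; apply: ler_wpM2l.
    by rewrite one_subr_exp_ge0// mulr_ge0// vnorm2_ge0.
  rewrite lerD2l lerN2 ler_expR lerN2; apply: (ler_wpM2l q0).
  by rewrite /w' -scalemxAl [X in _ <= cabs2 X]mxE cabs2M cabs2_real ler_peMl// cabs2_ge0.
(* After the rescaling both sides share the two marginal terms, and only the joint term is left to
   compare. *)
rewrite [leLHS](cgauss_expect_receive_kernel w' p0 q0).
rewrite [leRHS](cgauss_expect_receive_kernel (ctrmx u) p0 q0).
rewrite w'E ctrmxK ul (qform_inv_pencil_top p0) lee_fin.
have [D0 _] := det_pencil cA qA0 p0.
have pl0 : 0 < 1 + p * l by rewrite ltr_pwDl// mulr_ge0// ltW.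
(* The lower bound at S w'^H, whose squared norm is [l], is exactly the value attained at the top
   eigenvector. *)
have k0 : l / (1 + p * l) <= qform (invmx (pencil A p)) (S *m ctrmx w').
  have := qform_inv_pencil_ge (S *m ctrmx w') p0.
  by rewrite vnorm2_root w'E ler_pdivrMr// [_ * (1 + _)]mulrC.
have k1 : 0 <= l / (1 + p * l) by rewrite divr_ge0// ltW.
rewrite lerD2r lerD2l lef_pV2 ?posrE.
- by apply: (ler_wpM2l (ltW D0)); rewrite lerD2l; exact: ler_wpM2l.
- by rewrite mulr_gt0// ltr_pwDl// mulr_ge0// (le_trans k1).
- by rewrite mulr_gt0// ltr_pwDl// mulr_ge0.
Qed.

(** The factor of the kernel that depends on [h_2]; with [h_1] fixed, [q] stands for s k1
    ||h_1||^2. *)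
Definition transmit_kernel q (w : 'cV[C]_n) (h : 'rV[C]_n) : R :=
  1 - expR (- (q * cabs2 ((h *m S *m w) 0 0))).

Lemma transmit_kernel_ge0 q w h : 0 <= q -> 0 <= transmit_kernel q w h.
Proof. by move=> q0; rewrite one_subr_exp_ge0// mulr_ge0// cabs2_ge0. Qed.

Lemma cgauss_expect_transmit_kernel q w : 0 <= q ->
  cgauss_expect n (fun v => (transmit_kernel q w (\row_i v i))%:E) =
  (1 - (1 + q * qform A w)^-1)%:E.
Proof.
(* Transposing without conjugation turns the row channel into a column with the same coordinates, so
   that the column formula applies; the norm is unchanged. *)
move=> q0; pose L := (S *m w)^T.
have LE : vnorm2 L = qform A w.
  rewrite -vnorm2_root /vnorm2 exchange_big; apply: eq_bigr => i _.
  by apply: eq_bigr => j _; rewrite mxE.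
have kE v : transmit_kernel q w (\row_i v i) = 1 - expR (- (q * cabs2 ((L *m col v) 0 0))).
  congr (1 - expR (- (_ * cabs2 _))); rewrite -mulmxA !mxE.
  by apply: eq_bigr => i _; rewrite ![in RHS]mxE [in LHS]mxE [RHS]mulrC mxE.
pose f v := (expR (- (q * cabs2 ((L *m col v) 0 0))))%:E.
have mf : vmeasurable f.
  move=> d T v mv; apply/measurable_EFinP; apply: measurableT_comp => //.
  apply: measurableT_comp => //; apply: measurable_funM => //; apply: measurable_cabs2.
  have mL : mxmeasurable (fun t => L *m col (v t)).
    by apply: mxmeasurableM; [exact: mxmeasurable_cst|exact: mxmeasurable_col].
  exact: mL.
have ef : cgauss_expect n f = ((1 + q * qform A w)^-1)%:E.
  have := cgauss_expect_exp2 cA qA0 L (lexx 0) q0.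
  rewrite pencil0 det1 invmx1 qform1 vnorm2_ctrmx mul1r LE => <-.
  by congr cgauss_expect; apply/funext => v; rewrite mul0r oppr0 expR0 mul1r.
set X := LHS; have : (X + ((1 + q * qform A w)^-1)%:E = 1)%E.
  rewrite -ef /X -cgauss_expectD//.
  - rewrite -[RHS](cgauss_expect_cst n); congr cgauss_expect; apply/funext => v.
    by rewrite /f kE -EFinD subrK.
  - move=> d T v mv; apply/measurable_EFinP; under eq_fun do rewrite kE.
    by apply: measurable_funB => //; apply/measurable_EFinP; exact: mf.
  - by move=> v; rewrite lee_fin transmit_kernel_ge0.
  - by move=> v; rewrite lee_fin expR_ge0.
by case: X => [r| |]//; rewrite -EFinD => -[] h; congr EFin; lra.
Qed.

Lemma transmit_optimal q w : 0 <= q -> vnorm2 w = 1 ->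
  (cgauss_expect n (fun v => (transmit_kernel q w (\row_i v i))%:E) <=
   cgauss_expect n (fun v => (transmit_kernel q u (\row_i v i))%:E))%E.
Proof.
move=> q0 w1; rewrite !cgauss_expect_transmit_kernel// lee_fin.
have [_ ->] := top_eigenvalueE; have l0 := top_eigenvalue_gt0.
have wl : qform A w <= l by have := qform_le_top w; rewrite w1 mulr1.
rewrite lerD2l lerN2 lef_pV2 ?posrE ?ltr_pwDl ?mulr_ge0 ?qA0 ?(ltW l0)//.
by rewrite lerD2l; exact: ler_wpM2l.
Qed.

End TopEigenvector.

(** * From the optimality of each hop to the joint optimality of the pair *)

Section Channel.
Context {R : realType} (n : nat).
Local Notation C := (R[i]).
Local Notation mR := (measurableTypeR R).
Local Notation mu := (@lebesgue_measure R).
Variables (k1 k2 : R) (Sr St : 'M[C]_n).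
Hypotheses (k10 : 0 <= k1) (k20 : 0 <= k2).

(** [hop1] and [hop2] are the terms y = k2 b and x = k1 a c in the denominator of [Gamma]; the
    second one also involves [h1], through a. *)
Definition hop1 (wr : 'rV[C]_n) (h1 : 'cV[C]_n) : R := k2 * cabs2 ((wr *m (Sr *m h1)) 0 0).

Definition hop2 (wt : 'cV[C]_n) (h1 : 'cV[C]_n) (h2 : 'rV[C]_n) : R :=
  k1 * vnorm2 (Sr *m h1) * cabs2 ((h2 *m St *m wt) 0 0).

Lemma hop1_ge0 wr h1 : 0 <= hop1 wr h1.
Proof. by rewrite mulr_ge0// cabs2_ge0. Qed.

Lemma hop2_ge0 wt h1 h2 : 0 <= hop2 wt h1 h2.
Proof. by rewrite mulr_ge0 ?cabs2_ge0// mulr_ge0// vnorm2_ge0. Qed.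

Definition channel_kernel s wr wt h1 h2 : R :=
  laplace_kernel (hop2 wt h1 h2) (hop1 wr h1) s.

Lemma channel_kernel_ge0 s wr wt h1 h2 : 0 <= channel_kernel s wr wt h1 h2.
Proof. exact: (laplace_kernel_ge0 s (hop2_ge0 wt h1 h2) (hop1_ge0 wr h1)). Qed.

Lemma measurable_channel_kernel d (T : measurableType d) wr wt
    (s : T -> R) (h1 : T -> 'cV[C]_n) (h2 : T -> 'rV[C]_n) :
  measurable_fun setT s -> mxmeasurable h1 -> mxmeasurable h2 ->
  measurable_fun setT (fun t => channel_kernel (s t) wr wt (h1 t) (h2 t)).
Proof.
move=> ms m1 m2.
have mS : mxmeasurable (fun t => Sr *m h1 t).
  by apply: mxmeasurableM => //; exact: mxmeasurable_cst.
have mw : mxmeasurable (fun t => wr *m (Sr *m h1 t)).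
  by apply: mxmeasurableM => //; exact: mxmeasurable_cst.
have mt : mxmeasurable (fun t => h2 t *m St *m wt).
  apply: mxmeasurableM; last exact: mxmeasurable_cst.
  by apply: mxmeasurableM => //; exact: mxmeasurable_cst.
apply: measurable_laplace_kernel => //.
  apply: measurable_funM; last by apply: measurable_cabs2; exact: mt.
  by apply: measurable_funM => //; exact: measurable_vnorm2.
by apply: measurable_funM => //; apply: measurable_cabs2; exact: mw.
Qed.

Let F s wr wt (v w : nat -> C) : \bar R :=
  (channel_kernel s wr wt (\col_i v i) (\row_i w i))%:E.

Let mF s wr wt : vvmeasurable (F s wr wt).
Proof.
move=> d T u v mu_ mv; apply/measurable_EFinP; apply: measurable_channel_kernel.
- exact: measurable_cst.
- exact: mxmeasurable_col.
- exact: (mxmeasurable_row 0 mv).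
Qed.

Let F0 s wr wt v w : (0 <= F s wr wt v w)%E.
Proof. by rewrite lee_fin; exact: channel_kernel_ge0. Qed.

Variables (Rr Rt : 'M[C]_n) (lambda1 sigma1 : C) (ur wt : 'cV[C]_n).
Hypotheses (hRr : Rr \is hermsymmx) (pRr : posdefmx Rr).
Hypotheses (hRt : Rt \is hermsymmx) (pRt : posdefmx Rt).
Hypotheses (hSr : Sr \is hermsymmx) (SSr : Sr *m Sr = Rr).
Hypotheses (hSt : St \is hermsymmx) (SSt : St *m St = Rt).
Hypotheses (lambda1P : forall l, eigenvalue Rr l -> l <= lambda1).
Hypotheses (sigma1P : forall s, eigenvalue Rt s -> s <= sigma1).
Hypotheses (Rur : Rr *m ur = lambda1 *: ur) (ur1 : vnorm2 ur = 1).
Hypotheses (Rwt : Rt *m wt = sigma1 *: wt) (wt1 : vnorm2 wt = 1).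

(** With [h1] outside, the inner expectation is a constant [c >= 0] times that of [transmit_kernel],
    so the comparison holds for each [h1] and every receive vector. *)
Lemma channel_kernel_transmit s wr wt' : 0 <= s -> vnorm2 wt' = 1 ->
  (channel_expect (fun h1 h2 => (channel_kernel s wr wt' h1 h2)%:E) <=
   channel_expect (fun h1 h2 => (channel_kernel s wr wt h1 h2)%:E))%E.
Proof.
move=> s0 wt'1; rewrite [leLHS]channel_expectE [leRHS]channel_expectE.
apply: le_cgauss_expect.
- exact: vmeasurable_cgauss_expect (mF s wr wt') (F0 s wr wt').
- exact: vmeasurable_cgauss_expect (mF s wr wt) (F0 s wr wt).
- by move=> v; apply: cgauss_expect_ge0 => w; exact: F0.
move=> v; pose h1 := \col_(i < n) v i.
pose q := s * (k1 * vnorm2 (Sr *m h1)); pose c := 1 - expR (- (s * hop1 wr h1)).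
have q0 : 0 <= q by rewrite !mulr_ge0 ?vnorm2_ge0.
have c0 : 0 <= c by rewrite one_subr_exp_ge0// mulr_ge0 ?hop1_ge0.
have E w : cgauss_expect n (fun u => (channel_kernel s wr w h1 (\row_i u i))%:E) =
    (c%:E * cgauss_expect n (fun u => (transmit_kernel St q w (\row_i u i))%:E))%E.
  rewrite -cgauss_expectZl; last 3 first.
  - exact: c0.
  - move=> d T u mu_; apply/measurable_EFinP.
    have mt : mxmeasurable (fun t => \row_i u t i *m St *m w).
      apply: mxmeasurableM; last exact: mxmeasurable_cst.
      apply: mxmeasurableM; last exact: mxmeasurable_cst.
      exact: (mxmeasurable_row 0 mu_).
    apply: measurable_funB => //; apply: measurableT_comp => //.
    apply: measurableT_comp => //; apply: measurable_funM => //.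
    by apply: measurable_cabs2; exact: mt.
  - by move=> u; rewrite lee_fin; exact: transmit_kernel_ge0.
  apply: (congr1 (cgauss_expect n)); apply/funext => u; rewrite -EFinM; congr EFin.
  by rewrite mulrC; congr ((1 - expR (- _)) * _); rewrite /hop2 mulrA.
rewrite [leLHS]E [leRHS]E; apply: lee_wpmul2l; first by rewrite lee_fin.
exact: (transmit_optimal hRt pRt hSt SSt sigma1P Rwt wt1).
Qed.

(** The expectations are exchanged so that [h1] is integrated first; [receive_optimal] then applies
    for each [h2], whatever the transmit vector. *)
Lemma channel_kernel_receive s wr' w : 0 <= s -> vnorm2 wr' = 1 ->
  (channel_expect (fun h1 h2 => (channel_kernel s wr' w h1 h2)%:E) <=
   channel_expect (fun h1 h2 => (channel_kernel s (ctrmx ur) w h1 h2)%:E))%E.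
Proof.
move=> s0 wr'1; rewrite [leLHS]channel_expectE [leRHS]channel_expectE.
rewrite [leLHS](cgauss_expect_swap n n (mF s wr' w) (F0 s wr' w)).
rewrite [leRHS](cgauss_expect_swap n n (mF s (ctrmx ur) w) (F0 s (ctrmx ur) w)).
have mG wr := vmeasurable_cgauss_expect n (vvmeasurable_flip (mF s wr w))
  (fun v u => F0 s wr w u v).
apply: le_cgauss_expect.
- exact: mG.
- exact: mG.
- by move=> v; apply: cgauss_expect_ge0 => u; exact: F0.
move=> u; pose h2 := \row_(i < n) u i.
pose p := s * (k1 * cabs2 ((h2 *m St *m w) 0 0)); pose q := s * k2.
have p0 : 0 <= p by rewrite !mulr_ge0 ?cabs2_ge0.
have q0 : 0 <= q by rewrite mulr_ge0.
have E wr : cgauss_expect n (fun v => (channel_kernel s wr w (\col_i v i) h2)%:E) =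
    cgauss_expect n (fun v => (receive_kernel Sr p q wr (\col_i v i))%:E).
  apply: (congr1 (cgauss_expect n)); apply/funext => v; congr EFin.
  rewrite /channel_kernel /laplace_kernel /receive_kernel /hop1 /hop2.
  by congr ((1 - expR (- _)) * (1 - expR (- _))); rewrite /p /q; ring.
rewrite [leLHS]E [leRHS]E.
exact: (receive_optimal hRr pRr hSr SSr lambda1P Rur ur1 p0 q0 wr'1).
Qed.

Let G wr w (p : mR * mR) (v : nat -> C) : \bar R :=
  ((ln 2)^-1 * laplace_weight p *
   channel_kernel p.2 wr w (\col_(i < n) v i) (\row_(i < n) v (n + i)%N))%:E.

Let mG wr w : pmeasurable (G wr w).
Proof.
move=> d T phi u mphi mu_; apply/measurable_EFinP; apply: measurable_funM.
  apply: measurable_funM => //; apply: (measurableT_comp _ mphi).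
  exact: measurable_laplace_weight.
apply: measurable_channel_kernel.
- exact: (measurableT_comp measurable_snd mphi).
- exact: mxmeasurable_col.
- exact: (mxmeasurable_row n mu_).
Qed.

Let ln2_gt0 : 0 < ln 2 :> R. Proof. by rewrite ln_gt0// ltr1n. Qed.

Let G0 wr w p v : (0 <= G wr w p v)%E.
Proof.
rewrite lee_fin mulr_ge0 ?channel_kernel_ge0//.
by rewrite mulr_ge0 ?laplace_weight_ge0// invr_ge0 ltW.
Qed.

Lemma channel_expect_log2 wr w :
  channel_expect (fun h1 h2 =>
    (log2 (1 + hop2 w h1 h2 * hop1 wr h1 / (hop2 w h1 h2 + hop1 wr h1 + 1)))%:E)
  = (\int[mu]_t \int[mu]_s cgauss_expect (n + n) (G wr w (t, s)))%E.
Proof.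
rewrite -(cgauss_expect_integral2 (n + n) mu mu (mG wr w) (G0 wr w)).
apply: (congr1 (cgauss_expect _)); apply/funext => v.
set h1 := \col_(i < n) v i; set h2 := \row_(i < n) v (n + i)%N.
rewrite /log2 mulrC EFinM -(ln_laplace_weight (hop2_ge0 w h1 h2) (hop1_ge0 wr h1)).
have mk : measurable_fun setT (fun p : mR * mR =>
    (laplace_weight p * laplace_kernel (hop2 w h1 h2) (hop1 wr h1) p.2)%:E).
  apply/measurable_EFinP; apply: measurable_funM; first exact: measurable_laplace_weight.
  by apply: measurable_laplace_kernel => //; exact: measurable_cst.
have k0 (p : mR * mR) :
    (0 <= (laplace_weight p * laplace_kernel (hop2 w h1 h2) (hop1 wr h1) p.2)%:E)%E.
  rewrite lee_fin; apply: mulr_ge0; first exact: laplace_weight_ge0.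
  exact: channel_kernel_ge0.
have c0 : (0 <= ((ln 2)^-1 : R)%:E)%E by rewrite lee_fin invr_ge0 ltW.
rewrite -ge0_integralZl; last 4 first.
- exact: measurableT.
- exact: (measurable_fun_fubini_tonelli_F (m2 := mu) _ mk k0).
- by move=> t _; apply: integral_ge0 => s _; exact: (k0 (t, s)).
- exact: c0.
apply: eq_integral => t _; rewrite -ge0_integralZl; last 4 first.
- exact: measurableT.
- exact: (measurable_fun_pair2 t mk).
- by move=> s _; exact: (k0 (t, s)).
- exact: c0.
by apply: eq_integral => s _; rewrite -EFinM mulrA.
Qed.

Lemma channel_expect_log2_le wr' wt' : vnorm2 wr' = 1 -> vnorm2 wt' = 1 ->
  (channel_expect (fun h1 h2 => (log2 (1 + hop2 wt' h1 h2 * hop1 wr' h1 /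
      (hop2 wt' h1 h2 + hop1 wr' h1 + 1)))%:E) <=
   channel_expect (fun h1 h2 => (log2 (1 + hop2 wt h1 h2 * hop1 (ctrmx ur) h1 /
      (hop2 wt h1 h2 + hop1 (ctrmx ur) h1 + 1)))%:E))%E.
Proof.
move=> wr'1 wt'1; rewrite [leLHS]channel_expect_log2 [leRHS]channel_expect_log2.
have mE wr w := measurable_cgauss_expect (n + n) (mG wr w) (G0 wr w).
have E0 wr w p : (0 <= cgauss_expect (n + n) (G wr w p))%E.
  by apply: cgauss_expect_ge0 => v; exact: G0.
apply: ge0_le_integral.
- exact: measurableT.
- by move=> t _; apply: integral_ge0 => s _; exact: E0.
- exact: (measurable_fun_fubini_tonelli_F (m2 := mu) _ (mE wr' wt') (E0 wr' wt')).
- exact: (measurable_fun_fubini_tonelli_F (m2 := mu) _ (mE (ctrmx ur) wt) (E0 (ctrmx ur) wt)).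
move=> t _; apply: ge0_le_integral.
- exact: measurableT.
- by move=> s _; exact: E0.
- exact: (measurable_fun_pair2 t (mE wr' wt')).
- exact: (measurable_fun_pair2 t (mE (ctrmx ur) wt)).
move=> s _; set p := (t, s).
have c0 : 0 <= (ln 2)^-1 * laplace_weight p.
  by rewrite mulr_ge0 ?laplace_weight_ge0// invr_ge0 ltW.
have E wr w : cgauss_expect (n + n) (G wr w p) =
    (((ln 2)^-1 * laplace_weight p)%:E *
      channel_expect (fun h1 h2 => (channel_kernel s wr w h1 h2)%:E))%E.
  rewrite /channel_expect -(cgauss_expectZl (n + n) c0).
  - by apply: (congr1 (cgauss_expect _)); apply/funext => v; rewrite /G EFinM.
  - move=> d T u mu_; apply/measurable_EFinP; apply: measurable_channel_kernel.
    + exact: measurable_cst.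
    + exact: mxmeasurable_col.
    + exact: (mxmeasurable_row n mu_).
  - by move=> v; rewrite lee_fin channel_kernel_ge0.
(* For [s < 0] the weight vanishes and both sides are 0. *)
rewrite [leLHS]E [leRHS]E; have [s0|s0] := leP 0 s; last first.
  have -> : laplace_weight p = 0; last by rewrite mulr0 [leLHS]mul0e [leRHS]mul0e.
  rewrite /laplace_weight [X in _ * X * _]indicE memNset ?mulr0 ?mul0r//.
  by rewrite /= in_itv/= andbT; apply/negP; rewrite -ltNge.
apply: lee_wpmul2l; first by rewrite lee_fin.
(* The transmit vector is replaced first while [wr'] is kept, then the receive vector; each
   comparison is uniform in the other vector. *)
apply: (le_trans (channel_kernel_transmit wr' s0 wt'1)).
exact: channel_kernel_receive.
Qed.

End Channel.

(** * Reduction of the capacity to the normalized form xy/(x+y+1) *)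

Unset Implicit Arguments.

Theorem theorem1 (R : realType) (N : nat) (eta theta rho d1 d2 tau : R)
    (Rr Rt Sr St : 'M[R[i]]_N) (lambda1 sigma1 : R[i]) (ur wt : 'cV[R[i]]_N) :
  (1 <= N)%N ->
  0 < eta <= 1 -> 0 < theta < 1 -> 0 < rho -> 0 < d1 -> 0 < d2 -> 0 < tau ->
  (* R_r, R_t Hermitian positive definite *)
  Rr \is hermsymmx -> posdefmx Rr -> Rt \is hermsymmx -> posdefmx Rt ->
  (* Sr = R_r^{1/2}, St = R_t^{1/2}: the Hermitian positive definite roots *)
  Sr \is hermsymmx -> posdefmx Sr -> Sr *m Sr = Rr ->
  St \is hermsymmx -> posdefmx St -> St *m St = Rt ->
  (* lambda1, sigma1 the largest eigenvalues of R_r, R_t *)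
  (forall l, eigenvalue Rr l -> l <= lambda1) ->
  (forall s, eigenvalue Rt s -> s <= sigma1) ->
  (* ur, wt unit eigenvectors for lambda1, sigma1 *)
  Rr *m ur = lambda1 *: ur -> vnorm2 ur = 1 ->
  Rt *m wt = sigma1 *: wt -> vnorm2 wt = 1 ->
  forall (wr' : 'rV[R[i]]_N) (wt' : 'cV[R[i]]_N),
    vnorm2 wr' = 1 -> vnorm2 wt' = 1 ->
    (capacity eta theta rho d1 d2 tau Sr St wr' wt'
     <= capacity eta theta rho d1 d2 tau Sr St (ctrmx ur) wt)%E.
Proof.
move=> _ /andP[eta0 _] /andP[theta0 theta1] rho0 d10 d20 _ hRr pRr hRt pRt.
move=> hSr _ SSr hSt _ SSt lP sP Rur ur1 Rwt wt1 wr' wt' wr'1 wt'1.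
pose k1 := eta * theta * rho / (d1 `^ tau * d2 `^ tau).
pose k2 := (1 - theta) * rho / d1 `^ tau.
have D10 : 0 < d1 `^ tau by exact: powR_gt0.
have D20 : 0 < d2 `^ tau by exact: powR_gt0.
have k10 : 0 <= k1 by rewrite ltW// divr_gt0 ?mulr_gt0.
have k20 : 0 <= k2 by rewrite ltW// divr_gt0 ?mulr_gt0// subr_gt0.
have GammaE wr w h1 h2 : Gamma eta theta rho d1 d2 tau Sr St wr w h1 h2 =
    hop2 k1 Sr St w h1 h2 * hop1 k2 Sr wr h1 /
    (hop2 k1 Sr St w h1 h2 + hop1 k2 Sr wr h1 + 1).
  rewrite /Gamma /hop1 /hop2 -/k1 -/k2; congr (_ / _).
  (* With this splitting of the power, the constant in the numerator of [Gamma] is [k1 * k2]. *)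
  have -> : d1 `^ (2 * tau) = d1 `^ tau * d1 `^ tau.
    rewrite -powRD; first by congr (powR d1 _); ring.
    by apply/implyP => _; rewrite gt_eqF.
  by rewrite /k1 /k2; field; rewrite !gt_eqF.
rewrite /capacity; apply: lee_wpmul2l; first by rewrite lee_fin invr_ge0.
under [X in (channel_expect X <= _)%E]eq_fun do under eq_fun do rewrite GammaE.
under [X in (_ <= channel_expect X)%E]eq_fun do under eq_fun do rewrite GammaE.
exact: (channel_expect_log2_le k10 k20 hRr pRr hRt pRt hSr SSr hSt SSt lP sP
  Rur ur1 Rwt wt1 wr'1 wt'1).
Qed.
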